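(* Assume that there is a measurable cardinal and let $\mu$ be the first measurable cardinal. Then the Hanf number for joint embedding satisfies $\mu_{\mathrm{JEP}}(\aleph_0)\ge\mu$.
   Context: Abstract Elementary Classes (AECs) are in the usual sense (Shelah), with the convention $\mathrm{LS}(\mathbf K)\ge|\tau(\mathbf K)|$. An AEC $\mathbf K$ satisfies $\mathrm{JEP}(\lambda)$ iff $\mathbf K$ has a member of size $\lambda$ and for all $M_0,M_1\in\mathbf K$ of size $\lambda$ there are $N\in\mathbf K$ (of any size) and $\mathbf K$-embeddings $f_\ell:M_\ell\to N$, $\ell=0,1$. For a cardinal $\kappa$, the Hanf number for joint embedding $\mu_{\mathrm{JEP}}(\kappa)$ is the least cardinal $\nu$ such that for every AEC $\mathbf K$ with $\mathrm{LS}(\mathbf K)=\kappa$: if $\mathbf K$ satisfies $\mathrm{JEP}(\lambda)$ for cofinally many cardinals $\lambda<\nu$, then $\mathbf K$ satisfies $\mathrm{JEP}(\lambda)$ for every cardinal $\lambda\ge\nu$. *)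

(* Defs.v *)
From mathcomp Require Import all_boot.
From mathcomp Require Import boolp classical_sets functions cardinality filter.
From mathcomp Require wochoice.

Set Implicit Arguments.
Unset Strict Implicit.
Unset Printing Implicit Defensive.

Local Open Scope classical_set_scope.
Local Open Scope card_scope.

(* One fixed universe of types plays the role of the universe of sets.  Naming
   it keeps every quantifier over models and over cardinals at the same universe
   level, which separate occurrences of [Type] would not guarantee.
   A cardinal is represented by any small type having that cardinality, so that
   cardinals are only meaningful up to equipotence. *)
Definition Small := Type.

Definition cle (A B : Small) : Prop := [set: A] #<= [set: B].
Definition clt (A B : Small) : Prop := cle A B /\ ~ cle B A.

Definition is_least (P : Small -> Prop) (A : Small) : Prop :=
  P A /\ forall B : Small, P B -> cle A B.

(* First-order vocabularies, structures and their maps *)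

Record vocabulary := Vocabulary {
  rsym : Small;
  fsym : Small;
  rarity : rsym -> nat;
  farity : fsym -> nat }.

(* The universe of a structure is a subset of an ambient small type, so that
   inclusions of structures and unions of chains are literal ones, as in set
   theory.  It may be empty. *)
Record structure (tau : vocabulary) (T : Small) := Structure {
  univ :> set T;
  rint : forall R : rsym tau, ('I_(rarity R) -> univ) -> Prop;
  fint : forall F : fsym tau, ('I_(farity F) -> univ) -> univ }.

Section Maps.
Context (tau : vocabulary).

Record embedding (T T' : Small) (M : structure tau T) (N : structure tau T')
    (f : M -> N) : Prop := {
  embedding_inj : injective f;
  embedding_rel : forall (R : rsym tau) (a : 'I_(rarity R) -> M),
    rint a <-> rint (f \o a);
  embedding_fun : forall (F : fsym tau) (a : 'I_(farity F) -> M),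
    f (fint a) = fint (f \o a) }.

Definition isomorphism (T T' : Small) (M : structure tau T)
    (N : structure tau T') (f : M -> N) : Prop :=
  embedding f /\ bijective f.

Definition substructure (T : Small) (M N : structure tau T) : Prop :=
  exists2 f : M -> N, embedding f & forall x, val (f x) = val x.

End Maps.

(* Abstract elementary classes *)

Record abstract_class := AbstractClass {
  voc : vocabulary;
  member : forall T : Small, structure voc T -> Prop;
  strong : forall T : Small, structure voc T -> structure voc T -> Prop }.

Definition wo_lt (I : Small) (le : rel I) (i j : I) : Prop := le i j /\ i <> j.

(* The order type of [le] is a limit ordinal. *)
Definition limit_order (I : Small) (le : rel I) : Prop :=
  [/\ wochoice.well_order le, inhabited I & forall i, exists j, wo_lt le i j].

Definition limit_point (I : Small) (le : rel I) (i : I) : Prop :=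
  (exists j, wo_lt le j i) /\
  forall j, wo_lt le j i -> exists2 k, wo_lt le j k & wo_lt le k i.

Definition continuous_chain (K : abstract_class) (T I : Small) (le : rel I)
    (M : I -> structure (voc K) T) : Prop :=
  [/\ forall i, member (M i),
      forall i j, wo_lt le i j -> strong (M i) (M j) &
      forall i, limit_point le i ->
        univ (M i) = \bigcup_(j in [set j | wo_lt le j i]) univ (M j)].

(* The second condition determines the structure on the union. *)
Definition union_of (tau : vocabulary) (T I : Small) (M : I -> structure tau T)
    (U : structure tau T) : Prop :=
  univ U = \bigcup_i univ (M i) /\ forall i, substructure (M i) U.

(* [kappa] is an infinite cardinal, at least the number of symbols, for which
   the downward Loewenheim-Skolem axiom holds. *)
Definition ls_bound (K : abstract_class) (kappa : Small) : Prop :=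
  [/\ infinite_set [set: kappa],
      cle (rsym (voc K) + fsym (voc K))%type kappa &
      forall (T : Small) (M : structure (voc K) T) (A : set T),
        member M -> A `<=` univ M ->
        exists N : structure (voc K) T,
          [/\ strong N M, A `<=` univ N & univ N #<= [set: (A + kappa)%type]]].

Record is_aec (K : abstract_class) : Prop := {
  aec_member_iso : forall (T T' : Small) (M : structure (voc K) T)
      (N : structure (voc K) T') (f : M -> N),
    isomorphism f -> member M -> member N;
  aec_strong_iso : forall (T T' : Small) (M N : structure (voc K) T)
      (M' N' : structure (voc K) T') (g : M -> M') (f : N -> N'),
    isomorphism g -> isomorphism f -> substructure M' N' ->
    (forall x y, val x = val y -> val (g x) = val (f y)) ->
    strong M N -> strong M' N';
  aec_strong_member : forall (T : Small) (M N : structure (voc K) T),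
    strong M N -> member M /\ member N;
  aec_strong_sub : forall (T : Small) (M N : structure (voc K) T),
    strong M N -> substructure M N;
  aec_strong_refl : forall (T : Small) (M : structure (voc K) T),
    member M -> strong M M;
  aec_strong_trans : forall (T : Small) (M N P : structure (voc K) T),
    strong M N -> strong N P -> strong M P;
  aec_coherence : forall (T : Small) (M N P : structure (voc K) T),
    substructure M N -> strong M P -> strong N P -> strong M N;
  aec_chain : forall (T I : Small) (le : rel I)
      (M : I -> structure (voc K) T) (U : structure (voc K) T),
    limit_order le -> continuous_chain le M -> union_of M U ->
    [/\ member U,
        forall i, strong (M i) U &
        forall N, (forall i, strong (M i) N) -> strong U N];
  aec_ls : exists kappa : Small, ls_bound K kappa }.

Definition is_LS (K : abstract_class) (kappa : Small) : Prop :=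
  is_least (ls_bound K) kappa.

Definition strong_embedding (K : abstract_class) (T T' : Small)
    (M : structure (voc K) T) (N : structure (voc K) T') (f : M -> N) : Prop :=
  exists M' : structure (voc K) T', strong M' N /\
    exists2 g : M -> M', isomorphism g & forall x, val (g x) = val (f x).

(* Joint embedding *)

Definition JEP (K : abstract_class) (lambda : Small) : Prop :=
  (exists (T : Small) (M : structure (voc K) T),
     member M /\ univ M #= [set: lambda]) /\
  forall (T0 T1 : Small) (M0 : structure (voc K) T0)
      (M1 : structure (voc K) T1),
    member M0 -> univ M0 #= [set: lambda] ->
    member M1 -> univ M1 #= [set: lambda] ->
    exists (T : Small) (N : structure (voc K) T) (f0 : M0 -> N) (f1 : M1 -> N),
      [/\ member N, strong_embedding f0 & strong_embedding f1].

Definition cofinally_below (P : Small -> Prop) (nu : Small) : Prop :=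
  forall alpha : Small, clt alpha nu ->
    exists lambda : Small, [/\ cle alpha lambda, clt lambda nu & P lambda].

Definition JEP_hanf_property (kappa nu : Small) : Prop :=
  forall K : abstract_class, is_aec K -> is_LS K kappa ->
    cofinally_below (JEP K) nu ->
    forall lambda : Small, cle nu lambda -> JEP K lambda.

(* [nu] is the Hanf number for joint embedding of [kappa]. *)
Definition is_mu_JEP (kappa nu : Small) : Prop :=
  is_least (JEP_hanf_property kappa) nu.

(* Measurable cardinals *)

(* closed under intersections of fewer than [kappa] members *)
Definition complete_filter (kappa : Small) (X : Small) (F : set_system X) :
    Prop :=
  forall (I : Small) (A : I -> set X),
    clt I kappa -> (forall i, F (A i)) -> F (\bigcap_i A i).

Definition measurable_cardinal (kappa : Small) : Prop :=
  ~ countable [set: kappa] /\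
  exists F : set_system kappa,
    [/\ UltraFilter F, forall x : kappa, ~ F [set x] & complete_filter kappa F].

Definition first_measurable (mu : Small) : Prop :=
  is_least measurable_cardinal mu.

(* Main.v *)
(* Fix [nu] below the first measurable cardinal [mu].  An abstract elementary
   class with countable Loewenheim-Skolem number that has joint embedding
   cofinally below [nu] but not at some [lambda >= nu] refutes [nu].

   The full tower over a set [X] has levels [T_0 = X] and
   [T_(n+1) = T_n -> nat], evaluation being coded by countably many relations.
   A new point of level 0 would evaluate every function [X -> nat] to a standard
   natural number, hence would yield a countably complete nonprincipal
   ultrafilter on [X], which does not exist for [X] below [mu]; new elements of
   higher levels are excluded by extensionality.  So full towers have no proper
   extension.  In the classes used here every element of a model carries its own
   (not necessarily full) tower on the whole model (a "bubble"): two models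
   embed jointly as soon as each of their bubbles can take in enough new
   elements, whereas a model all of whose bubbles are full is maximal.

   A bubble of size [kappa] can be extended by [kappa] new functions unless all
   its levels [X_n] below the top one satisfy [kappa >= aleph_0 ^ X_n].  With
   two levels this forces [kappa] to be a power [aleph_0 ^ chi]; with infinitely
   many levels Koenig's argument forces [kappa] not to be an uncountable such
   power.  Cofinally many cardinals below [nu] are of one of the two kinds, and
   both classes fail joint embedding at the size of the full tower over [nu].
   When all cardinals below [nu] are countable, a class with only countable
   models does the job. *)

From mathcomp Require Import all_boot.
From mathcomp Require Import boolp classical_sets functions cardinality filter.
From mathcomp Require wochoice.
Require Import Defs.

Set Implicit Arguments.
Unset Strict Implicit.
Unset Printing Implicit Defensive.

Local Open Scope classical_set_scope.
Local Open Scope card_scope.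

(** * Cardinal arithmetic *)

Lemma cleP (A B : Small) : cle A B <-> exists f : A -> B, injective f.
Proof.
rewrite /cle; split=> [/card_leP[f]|[f fI]].
  exists (fun x => val (f (SigSub (in_setT x)))) => x y /val_inj.
  by move=> /(inj (in_setT _) (in_setT _)) /(congr1 val).
apply/card_leP/injfunPex.
by exists (fun x => SigSub (in_setT (f (val x)))) => // x y _ _ [/fI/val_inj].
Qed.

Lemma cle_inj (A B : Small) (f : A -> B) : injective f -> cle A B.
Proof. by move=> fI; apply/cleP; exists f. Qed.

Lemma cle_refl (A : Small) : cle A A.
Proof. exact: card_lexx. Qed.

Lemma cle_trans (A B C : Small) : cle A B -> cle B C -> cle A C.
Proof. exact: card_le_trans. Qed.

Lemma cle_surj (A B : Small) (f : A -> B) : (forall y, exists x, f x = y) ->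
  cle B A.
Proof. by move=> /choice[g gK]; exact: (cle_inj (can_inj gK)). Qed.

(** Decides membership in the range of [f], so that data can be carried along an injection and given
    default values elsewhere. *)
Lemma partial_inverse (A B : Small) (f : A -> B) :
  exists r : B -> option A, forall y,
    match r y with Some x => f x = y | None => forall x, f x <> y end.
Proof.
suff /choice[r rP] y : exists o,
    match o with Some x => f x = y | None => forall x, f x <> y end by exists r.
have [[x e]|no] := pselect (exists x, f x = y); first by exists (Some x).
by exists None => x e; apply: no; exists x.
Qed.

Lemma cle_setT (X : Small) : cle X [set: X].
Proof. by apply: (@cle_inj X [set: X] (fun x => SigSub (in_setT x))) =>
  x y []. Qed.

Lemma card_le_cle (T U : Small) (A : set T) (B : set U) :
  (A #<= B) <-> cle A B.
Proof.
rewrite /cle; split=> AB.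
  have := card_setT A; rewrite card_eq_le => /andP[+ _] => /card_le_trans;
    apply.
  apply: card_le_trans AB _.
  by have := card_setT B; rewrite card_eq_le => /andP[].
have := card_setT A; rewrite card_eq_le => /andP[_] /card_le_trans; apply.
apply: card_le_trans AB _.
by have := card_setT B; rewrite card_eq_le => /andP[].
Qed.

Lemma card_eq_cle (T U : Small) (A : set T) :
  (A #= [set: U]) <-> cle A U /\ cle U A.
Proof.
have := card_setT A; rewrite card_eq_le => /andP[AT TA].
rewrite card_eq_le; split=> [/andP[AU UA]|[AU UA]].
  by split; [apply: card_le_trans AT AU|apply: card_le_trans UA TA].
by apply/andP; split; [apply: card_le_trans TA AU|apply: card_le_trans UA AT].
Qed.

(* A set of pointwise distinct choice functions that is maximal must exhaust
   some factor [B i]. *)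
Lemma cle_least_family (I : Small) (B : I -> Small) : inhabited I ->
  exists i, forall j, cle (B i) (B j).
Proof.
move=> [i0].
pose P (S : set (forall i, B i)) :=
  forall s t, S s -> S t -> (exists i, s i = t i) -> s = t.
have [F FP Ftot|A [PA maxA]] := @Zorn_bigcup _ P.
  move=> s t [S FS Ss] [S' FS' St].
  by case: (Ftot _ _ FS FS') => sub; [apply: (FP _ FS')|apply: (FP _ FS)];
    rewrite //; exact: sub.
have [i Ai] : exists i, forall b : B i, exists2 s, A s & s i = b.
  apply: contrapT => noi.
  have nb i : exists b : B i, forall s, A s -> s i <> b.
    apply: contrapT => nb; apply: noi; exists i => b.
    apply: contrapT => ns; apply: nb; exists b => s As sb.
    by apply: ns; exists s.
  pose t i := projT1 (cid (nb i)).
  have tA s i : A s -> s i <> t i by exact: (projT2 (cid (nb i))).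
  (* In each coordinate [t] avoids all values taken by members of [A], so adding it keeps distinct
     members pointwise distinct. *)
  apply: (maxA (A `|` [set t])).
    split=> [s|/(_ t (or_intror erefl))]; first by left.
    by move=> /(tA _ i0).
  move=> s s' [As|->] [As'|->] [i] //; first by move=> e; apply: PA => //;
    exists i.
    by move=> /(tA _ _ As).
  by move=> /esym/(tA _ _ As').
exists i => j.
pose s b := projT1 (cid2 (Ai b)).
have sA b : A (s b) by rewrite /s; case: (cid2 (Ai b)).
have si b : s b i = b by rewrite /s; case: (cid2 (Ai b)).
apply: (@cle_inj _ _ (fun b => s b j)) => b b' /= e.
by rewrite -(si b) -(si b'); congr (_ i); apply: PA => //; exists j.
Qed.

Lemma cle_total (A B : Small) : cle A B \/ cle B A.
Proof.
have [[] h] := @cle_least_family bool (fun b =>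
  if b then A else B) (inhabits true).
  by left; exact: (h false).
by right; exact: (h true).
Qed.

(** The subsets of [X] satisfying [P] form a small family, to which [cle_least_family] applies; a
    [B] satisfying [P] and not above [X] is equipotent with such a subset. *)
Lemma exists_least (P : Small -> Prop) (X : Small) :
  (forall A B, cle A B -> cle B A -> P A -> P B) -> P X ->
  exists A, is_least P A.
Proof.
move=> Pext PX.
pose I := {S : set X | P S}.
have PT : P [set: X].
  apply: Pext PX; last exact: (cle_inj val_inj).
  exact: cle_setT.
have [[S PS] minS] := @cle_least_family I (fun S => sval S :
  Small) (inhabits (exist _ _ PT)).
exists S; split=> // B PB.
have [XB|/cleP[f fI]] := cle_total X B.
  apply: cle_trans (minS (exist _ _ PT)) _; apply: cle_trans XB.
  exact: (cle_inj val_inj).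
have fB : cle B (range f).
  by apply: (@cle_inj _ _ (fun b => SigSub (mem_set (imageT f b)))) =>
    b c [/fI].
have Bf : cle (range f) B.
  apply: (@cle_surj _ _ (fun b => SigSub (mem_set (imageT f b)))) => y.
  by have [b _ fb] := set_valP y; exists b; exact: val_inj.
exact: cle_trans (minS (exist _ _ (Pext _ _ fB Bf PB))) Bf.
Qed.

Lemma cle_sum (A B A' B' : Small) :
  cle A A' -> cle B B' -> cle (A + B)%type (A' + B')%type.
Proof.
move=> /cleP[f fI] /cleP[g gI].
apply: (@cle_inj _ _ (fun x => match x with inl a => inl (f a) | inr b =>
  inr (g b) end)).
by move=> [a|b] [a'|b'] //= [] => [/fI|/gI] ->.
Qed.

Lemma cle_prod (A B A' B' : Small) :
  cle A A' -> cle B B' -> cle (A * B)%type (A' * B')%type.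
Proof.
move=> /cleP[f fI] /cleP[g gI].
apply: (@cle_inj _ _ (fun x => (f x.1, g x.2))).
by move=> [a b] [a' b'] /= [/fI-> /gI ->].
Qed.

Lemma cle_sum_prod (A : Small) : cle (A + A)%type (bool * A)%type.
Proof.
apply: (@cle_inj _ _ (fun x => match x with inl a => (true, a) | inr b =>
  (false, b) end)).
by move=> [a|b] [a'|b'] //= [] ->.
Qed.

Lemma cle_bool_nat : cle bool nat.
Proof. by apply: (@cle_inj _ _ nat_of_bool) => -[] []. Qed.

Lemma cle_setC (X : Small) (D : set X) : cle X (D + ~` D)%type.
Proof.
have dec x : exists s : D + (~` D : set X),
    match s with inl d => val d | inr d => val d end = x.
  have [Dx|nDx] := pselect (D x); first by exists (inl (SigSub (mem_set Dx))) .
  by exists (inr (SigSub (mem_set (nDx : (~` D) x)))).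
have [g gK] := choice dec.
by apply: (cle_inj (f := g)) => x y e; rewrite -(gK x) -(gK y) e.
Qed.

(** * Hessenberg's theorem on squares of infinite sets *)

Section Square.
Variables (X : Small) (i : nat -> X).
Hypothesis iI : injective i.

(* Graphs of injections of [D * D] into [D], where [D] is read off the graph. *)
Let D (G : set (X * X * X)) : set X := [set a | exists c, G (a, a, c)].

Let good (G : set (X * X * X)) := [/\
  forall a b c c', G (a, b, c) -> G (a, b, c') -> c = c',
  forall a b a' b' c, G (a, b, c) -> G (a', b', c) -> a = a' /\ b = b',
  forall a b c, G (a, b, c) -> [/\ D G a, D G b & D G c] &
  forall a b, D G a -> D G b -> exists c, G (a, b, c)].

Let G0 : set (X * X * X) :=
  [set t | exists m n, t = (i m, i n, i (pickle (m, n)))].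

Let good_G0 : good G0.
Proof.
have D0 n : D G0 (i n) by exists (i (pickle (n, n))), n, n.
split.
- move=> a b c c' [m [n [-> -> ->]]] [m' [n' [e1 e2 ->]]].
  by rewrite (iI e1) (iI e2).
- move=> a b a' b' c [m [n [-> -> ->]]] [m' [n' [-> -> e]]].
  have := iI e => /(pcan_inj pickleK) [-> ->]; by [].
- by move=> a b c [m [n [-> -> ->]]].
- move=> a b [c [m [n [-> _ _]]]] [c' [m' [n' [-> _ _]]]].
  by exists (i (pickle (m, m'))), m, m'.
Qed.

Let graph_max : exists G, [/\ good G, G0 `<=` G & forall G', G `<` G' ->
  ~ good G'].
Proof.
pose P G := good G /\ (G = set0 \/ G0 `<=` G).
have [F FP Ftot|G [[gG G0G] maxG]] := @Zorn_bigcup _ P.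
  have two t u : (\bigcup_(S in F) S) t -> (\bigcup_(S in F) S) u ->
      exists2 S, F S & S t /\ S u.
    move=> [S FS St] [S' FS' S'u].
    by case: (Ftot _ _ FS FS') => sub; [exists S'|exists S] => //; split=> //;
      exact: sub.
  split; last first.
    have [[S FS S0]|none] := pselect (exists2 S, F S & S <> set0).
      by right=> t G0t; exists S => //; case: (FP _ FS) => _ [//|]; apply.
    left; rewrite predeqE => t; split=> // -[S FS St].
    by apply: none; exists S => // S0; rewrite S0 in St.
  split.
  - move=> a b c c' h1 h2; have [S FS [S1 S2]] := two _ _ h1 h2.
    by case: (FP _ FS) => -[g1 _ _ _] _; exact: g1 S1 S2.
  - move=> a b a' b' c h1 h2; have [S FS [S1 S2]] := two _ _ h1 h2.
    by case: (FP _ FS) => -[_ g2 _ _] _; exact: g2 S1 S2.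
  - move=> a b c [S FS St]; case: (FP _ FS) =>
      -[_ _ /(_ _ _ _ St)[[x xS] [y yS] [z zS]] _] _.
    by split; [exists x|exists y|exists z]; exists S.
  - move=> a b [c ac] [d bd]; have [S FS [S1 S2]] := two _ _ ac bd.
    case: (FP _ FS) => -[_ _ _ g4] _.
    have [||e Se] := g4 a b; [by exists c|by exists d|].
    by exists e, S.
have G0G' : G0 `<=` G.
  case: G0G => // G_0; exfalso; apply: (maxG G0); last by split => //; right.
  rewrite G_0; split=> // /(_ (i 0, i 0, i (pickle (0, 0)))); apply.
  by exists 0, 0.
exists G; split=> // G' GG' gG'; apply: (maxG G' GG'); split=> //; right.
by apply: subset_trans G0G' _; case: GG'.
Qed.

(** A maximal graph lives on some [E]. If the complement of [E] injects into [E], then [X] has the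
    size of [E]. Otherwise the complement contains a copy of [E], over which the graph extends,
    against maximality. *)
Lemma cle_square_nat : cle (X * X)%type X.
Proof.
have [G [gG G0G maxG]] := graph_max.
have [g1 g2 g3 g4] := gG.
pose E : set X := D G.
have natE : cle nat E.
  have h n : E (i n) by exists (i (pickle (n, n))); apply: G0G; exists n, n.
  by apply: (@cle_inj _ _ (fun n => SigSub (mem_set (h n)))) => m n [/iI].
have EE : cle (E * E)%type E.
  have h (p : E * E) : exists c : E, G (val p.1, val p.2, val c).
    have [||c Gc] := g4 (val p.1) (val p.2); try exact: set_valP.
    by have [_ _ Dc] := g3 _ _ _ Gc; exists (SigSub (mem_set Dc)).
  have [f fG] := choice h.
  apply: (cle_inj (f := f)) => -[a b] [a' b'] e.
  have := fG (a, b); rewrite e => h1; have [/= e1 e2] :=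
    g2 _ _ _ _ _ h1 (fG (a', b')).
  by rewrite (val_inj e1) (val_inj e2).
have BE : cle (bool * E)%type E.
  apply: cle_trans EE; apply: cle_prod (cle_refl _).
  exact: cle_trans cle_bool_nat natE.
have [/cleP[h hI]|CE] := cle_total E (~` E); last first.
  have XE : cle X E.
    apply: cle_trans (cle_setC E) _; apply: cle_trans (cle_sum (cle_refl E) CE)
      _.
    exact: cle_trans (cle_sum_prod _) BE.
  apply: cle_trans (cle_prod XE XE) _; apply: cle_trans EE _.
  exact: (cle_inj val_inj).
have hE d : ~ E (val (h d)) by exact: (set_valP (h d)).
have Ed (d : E) : E (val d) by exact: set_valP.
have [q qI] : exists q : (bool * E) * (bool * E) -> E, injective q.
  by apply/cleP; apply: cle_trans (cle_prod BE BE) EE.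
(* [bool * E] stands for the union of [E] and its copy under [h], flag [true] meaning the copy; [q]
   codes pairs from this union by points of [E]. *)
pose dec (u : bool * E) : X := if u.1 then val (h u.2) else val u.2.
have decI : injective dec.
  move=> [[] d] [[] d']; rewrite /dec /=.
  - by move=> /val_inj/hI ->.
  - by move=> e; case: (@hE d); exact: (eq_ind _ E (Ed d') _ (esym e)).
  - by move=> e; case: (@hE d'); exact: (eq_ind _ E (Ed d) _ e).
  - by move=> /val_inj ->.
(* Only pairs that meet the copy are new; their values lie in the copy, hence differ from all values
   of [G]. *)
pose G1 : set (X * X * X) := [set t | exists u v, (u.1 || v.1) /\
  t = (dec u, dec v, val (h (q (u, v))))].
have decE u : E (dec u) -> u.1 = false.
  by case: u => -[] d //=; rewrite /dec /= => /hE.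
have DG' u : D (G `|` G1) (dec u).
  case: u => -[] d; first by exists (val (h (q ((true, d), (true, d))))); right;
    exists (true, d), (true, d).
  by have [c Gc] := Ed d; exists c; left.
have D'dec a : D (G `|` G1) a -> exists u, a = dec u.
  move=> [c [Gc|[u [v [_ [-> _ _]]]]]]; last by exists u.
  have [Da _ _] := g3 _ _ _ Gc.
  by exists (false, SigSub (mem_set Da)).
exfalso; apply: (maxG (G `|` G1)).
  split=> [t|sub]; first by left.
  have [d0] : inhabited E by case/cleP: natE => f _; exact: (inhabits (f 0)).
  have /g3[/decE //] : G (dec (true, d0), dec (true, d0), val (h (q ((true, d0),
    (true, d0))))).
  by apply: sub; right; exists (true, d0), (true, d0).
split.
- move=> a b c c' [h1|[u [v [uv [-> -> ->]]]]] [h2|[u' [v' [uv' [e1 e2 ->]]]]].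
  + exact: g1 h1 h2.
  + by have [+ +] := g3 _ _ _ h1; rewrite e1 e2 => /decE e /decE e';
      rewrite e e' in uv'.
  + by have [/decE e /decE e'] := g3 _ _ _ h2; rewrite e e' in uv.
  + by rewrite (decI _ _ e1) (decI _ _ e2).
- move=> a b a' b' c [h1|[u [v [uv [-> -> ->]]]]] [h2|[u' [v' [uv' [-> ->
    e]]]]].
  + exact: g2 h1 h2.
  + by have [_ _] := g3 _ _ _ h1; rewrite e => /hE.
  + by have [_ _ /hE] := g3 _ _ _ h2.
  + by move: e => /val_inj/hI/qI [-> ->].
- move=> a b c [/g3[[x Gx] [y Gy] [z Gz]]|[u [v [uv [-> -> ->]]]]].
    by split; [exists x|exists y|exists z]; left.
  by split; [exact: DG'|exact: DG'|exact: (DG' (true, _))].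
- move=> a b /D'dec[u ->] /D'dec[v ->].
  have [uv|] := boolP (u.1 || v.1).
    by exists (val (h (q (u, v)))); right; exists u, v.
  case: u v => -[] d [[] d'] //= _.
  by have [|c Gc] := g4 (val d) (val d') (Ed _); [exact: Ed|exists c; left].
Qed.

End Square.

Lemma cle_square (X : Small) : cle nat X -> cle (X * X)%type X.
Proof. by move=> /cleP[i iI]; exact: cle_square_nat iI. Qed.

Lemma cle_prod_inf (A B X : Small) : cle nat X ->
  cle A X -> cle B X -> cle (A * B)%type X.
Proof.
by move=> natX AX BX; exact: cle_trans (cle_prod AX BX) (cle_square natX).
Qed.

Lemma cle_sum_inf (A B X : Small) : cle nat X ->
  cle A X -> cle B X -> cle (A + B)%type X.
Proof.
move=> natX AX BX; apply: cle_trans (cle_sum AX BX) _.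
apply: cle_trans (cle_sum_prod X) _; apply: cle_prod_inf => //.
  exact: cle_trans cle_bool_nat natX.
exact: cle_refl.
Qed.

Lemma cantor (X : Small) : ~ cle (X -> nat) X.
Proof.
move=> /cleP[f fI].
pose g x : nat := if pselect (exists2 h, f h = x & h x = 0) then 1 else 0.
have : g (f g) = if pselect (exists2 h, f h = f g & h (f g) = 0) then 1 else 0
  by [].
case: pselect => [H|H] /= gE; first by case: H => h /fI ->; rewrite gE.
by case: H; exists g.
Qed.

(** * Countably complete ultrafilters *)

(* The least size of a family violating completeness is a measurable cardinal:
   push the ultrafilter forward along a map that sends each point outside the
   intersection of such a family to an index witnessing this. *)
Lemma measurable_le_complete_ultrafilter (mu X : Small) (U : set_system X) :
  first_measurable mu -> UltraFilter U -> (forall x, ~ U [set x]) ->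
  (forall A : nat -> set X, (forall n, U (A n)) -> U (\bigcap_n A n)) ->
  cle mu X.
Proof.
move=> [_ mu_min] UU Unp Uc.
have UF : Filter U by typeclasses eauto.
pose P (I : Small) := exists A : I -> set X,
  (forall i, U (A i)) /\ ~ U (\bigcap_i A i).
have Pext A B : cle A B -> cle B A -> P A -> P B.
  move=> /cleP[f fI] _ [F [UF' nF]].
  (* Fibres of [f] have at most one point, and an empty fibre gives the whole space. *)
  pose F' b := \bigcap_(a in [set a | f a = b]) F a.
  have FF' a : F' (f a) = F a.
    rewrite predeqE => x; split=> [|Fx a' /= /fI -> //]; exact.
  exists F'; split=> [b|]; last first.
    by apply: contra_not nF; apply: filterS => x h a _; rewrite -FF'; exact: h.
  have [[a <-]|no] := pselect (exists a, f a = b); first by rewrite FF'.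
  apply: filterS (@filterT _ U _) => x _ a /= e.
  by case: no; exists a.
have PX : P X.
  exists (fun x => ~` [set x]); split=> [x|].
    by case: (in_ultra_setVsetC [set x] UU) => // /Unp.
  rewrite (_ : \bigcap_x _ = set0); first exact: filter_not_empty.
  by rewrite predeqE => x; split=> // /(_ x I); apply.
have [I [PI minI]] := exists_least Pext PX.
apply: cle_trans (minI _ PX); apply: mu_min.
have [A [UA nA]] := PI; have Acompl : U (~` \bigcap_i A i).
  by case: (in_ultra_setVsetC (\bigcap_i A i) UU).
have [x0 x0A] : exists x, ~ (\bigcap_i A i) x.
  exact: (filter_ex Acompl).
have [i0 i0A] : exists i : I, ~ A i x0.
  by apply: contrapT => h; apply: x0A => i _; apply: contrapT => hi; apply: h;
    exists i.
have /choice[g gA] x : exists i, ~ (\bigcap_i A i) x -> ~ A i x.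
  have [h|h] := pselect ((\bigcap_i A i) x); first by exists i0.
  apply: contrapT => h'; apply: h => i _; apply: contrapT => hi.
  by apply: h'; exists i.
split.
  (* A countable [I] would contradict [Uc]. *)
  move=> /card_le_cle/cleP[f fI'].
  case: nA; pose A' n := \bigcap_(i in [set i |
    val (f (SigSub (in_setT i))) = n]) A i.
  have AA' i : A' (val (f (SigSub (in_setT i)))) = A i.
    rewrite predeqE => x; split=> [|Ax j /= /val_inj/fI'[-> //]]; exact.
  apply: filterS (Uc A' _) => [x h i _|n]; first by rewrite -AA'; exact: h.
  have [[i <-]|no] := pselect (exists i, val (f (SigSub (in_setT i))) = n).
    by rewrite AA'.
  by apply: filterS (@filterT _ U _) => x _ i /= e; case: no; exists i.
pose F : set_system I := [set S | U (g @^-1` S)].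
have FF : ProperFilter F.
  split; first by rewrite /F /= preimage_set0; exact: filter_not_empty.
  split; first by rewrite /F /= preimage_setT; exact: filterT.
    by move=> S S' FS FS'; rewrite /F /= preimage_setI; exact: filterI.
  by move=> S S' SS'; apply: filterS => x; exact: SS'.
exists F; split.
- split=> // G GG FG; rewrite predeqE => S; split=> [GS|/FG//].
  case: (in_ultra_setVsetC (g @^-1` S) UU) => // /(FG (~` S)) GnS.
  by case: (@filter_not_empty _ G _); rewrite -(setICr S); exact: filterI.
(* A point outside the intersection that [g] sends to [i] lies outside [A i], so three large sets
   have empty intersection. *)
- move=> i Fi; suff: U set0 by exact: filter_not_empty.
  have Ui : U (g @^-1` [set i]) by [].
  by apply: filterS (filterI (filterI Ui (UA i)) Acompl) => x [[/= <- Ax] /gA].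
(* A failure of completeness pulls back along [g] to a failure for [U], against the minimality of
   [I]. *)
- move=> J B [_ IJ] FB; apply: contrapT => nB; apply: IJ; apply: minI.
  exists (fun j => g @^-1` B j); split=> [j|]; first exact: FB.
  apply: contra_not nB => /(@filterS _ U _ _ (g @^-1` (\bigcap_j B j))); apply.
  by move=> x h j _; exact: h.
Qed.

(** * Universal classes as abstract elementary classes *)

Section Substructures.
Context (tau : vocabulary).

Lemma embedding_id (T : Small) (M : structure tau T) :
  embedding (fun x : M => x).
Proof.
by split=> [x y|R a|F a] //; rewrite (_ : _ \o a = a) //; exact: funext.
Qed.

Lemma embedding_comp (T T' T'' : Small) (M : structure tau T)
    (N : structure tau T') (P : structure tau T'') (f : M -> N) (g : N -> P) :
  embedding f -> embedding g -> embedding (g \o f).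
Proof.
move=> [fI fR fF] [gI gR gF]; split; first exact: inj_comp.
  by move=> R a; rewrite fR gR.
by move=> F a /=; rewrite fF gF.
Qed.

Lemma isomorphism_inv (T T' : Small) (M : structure tau T)
    (N : structure tau T') (f : M -> N) : isomorphism f ->
  exists g : N -> M, [/\ embedding g, cancel f g & cancel g f].
Proof.
move=> [[fI fR fF] [g fg gf]]; exists g; split=> //; split.
- exact: can_inj gf.
- move=> R a; rewrite fR (_ : f \o (g \o a) = a) //.
  by apply: funext => i /=; rewrite gf.
- move=> F a; apply: fI; rewrite gf fF (_ : f \o (g \o a) = a) //.
  by apply: funext => i /=; rewrite gf.
Qed.

Lemma substructure_refl (T : Small) (M : structure tau T) : substructure M M.
Proof. by exists id => //; exact: embedding_id. Qed.

Lemma substructure_trans (T : Small) (M N P : structure tau T) :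
  substructure M N -> substructure N P -> substructure M P.
Proof.
move=> [f fE fv] [g gE gv]; exists (g \o f); first exact: embedding_comp.
by move=> x /=; rewrite gv fv.
Qed.

Lemma embedding_factor (T T' T'' : Small) (M : structure tau T)
    (N : structure tau T') (P : structure tau T'') (f : M -> P) (g : N ->
      P) (h : M -> N) :
  embedding f -> embedding g -> (forall x, g (h x) = f x) -> embedding h.
Proof.
move=> [fI fR fF] [gI gR gF] gh; split.
- by move=> x y e; apply: fI; rewrite -!gh e.
- move=> R a; rewrite fR gR (_ : g \o (h \o a) = f \o a) //.
  by apply: funext => i /=; rewrite gh.
- move=> F a; apply: gI; rewrite gh fF gF (_ : g \o (h \o a) = f \o a) //.
  by apply: funext => i /=; rewrite gh.
Qed.

Lemma substructure_univ (T : Small) (M N : structure tau T) :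
  substructure M N -> univ M `<=` univ N.
Proof.
move=> [f _ fv] x Mx; have := fv (SigSub (mem_set Mx)) => /= <-.
exact: set_valP.
Qed.

Section Generated.
Context (T : Small) (M : structure tau T) (G : set T).
Hypothesis GM : G `<=` univ M.

Definition sub_incl (x : G) : M := SigSub (mem_set (GM (set_valP x))).

Hypothesis Gfun : forall (F : fsym tau) (a : 'I_(farity F) -> G),
  G (val (fint (sub_incl \o a))).

Definition sub_structure : structure tau T :=
  @Structure tau T G (fun R a => rint (sub_incl \o a))
    (fun F a => SigSub (mem_set (Gfun a))).

Lemma sub_structureP : substructure sub_structure M.
Proof.
exists (sub_incl : sub_structure -> M); last by [].
split=> //.
- by move=> x y /(congr1 val) /= /val_inj.
- by move=> F a; apply: val_inj.
Qed.

End Generated.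

Inductive term (A : Small) : Small :=
| Var of A
| App (F : fsym tau) of 'I_(farity F) -> term A.

Fixpoint eval (A T : Small) (M : structure tau T) (v : A -> M) (t : term A) :
  M :=
  match t with
  | Var a => v a
  | App F args => fint (fun i => eval v (args i))
  end.

Lemma cle_ord_fun (X : Small) n : cle nat X -> cle ('I_n -> X) X.
Proof.
move=> natX; elim: n => [|n IH].
  case/cleP: (natX) => i _; apply: (@cle_inj _ _ (fun=> i 0)) => f g _.
  by apply: funext => -[].
apply: cle_trans (cle_prod_inf natX (cle_refl X) IH).
apply: (@cle_inj _ _ (fun f => (f ord0, fun i => f (lift ord0 i)))) =>
  f g [e0 /funeqP e].
apply: funext => i; case: (unliftP ord0 i) => [j ->|-> //]; exact: e.
Qed.

Lemma cle_term (A X : Small) : cle nat X -> cle (fsym tau) X -> cle A X ->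
  cle (term A) X.
Proof.
move=> natX FX AX.
have XXX : cle (A + (fsym tau) * X)%type X.
  by apply: cle_sum_inf => //; apply: cle_prod_inf => //; exact: cle_refl.
have {XXX} /cleP[j jI] := XXX.
have exq n : exists q : ('I_n -> X) -> X, injective q by apply/cleP;
  exact: cle_ord_fun.
pose q n := projT1 (cid (exq n)).
have qI n : injective (q n) by exact: (projT2 (cid (exq n))).
pose fix enc (t : term A) : X := match t with
  | Var a => j (inl a)
  | App F args => j (inr (F, q (farity F) (fun i => enc (args i))))
  end.
apply: (cle_inj (f := enc)); elim=> [a|F args IH] [b|F' args'] /= /jI.
- by case=> ->.
- by [].
- by [].
- case=> FF'; case: _ / FF' args' => args' /qI/funeqP e.
  by congr App; apply: funext => i; apply: IH; exact: e.
Qed.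

(** The values of terms over [A] are closed under the functions, and there are no more of them than
    terms. *)
Lemma generated_substructure (T : Small) (M : structure tau T) (A : set T)
    (X : Small) :
  cle nat X -> cle (fsym tau) X -> cle A X -> A `<=` univ M ->
  exists N, [/\ substructure N M, A `<=` univ N & cle (univ N) X].
Proof.
move=> natX FX AX AM.
pose v (a : A) : M := SigSub (mem_set (AM _ (set_valP a))).
pose G : set T := range (fun t : term A => val (eval v t)).
have GM : G `<=` univ M by move=> _ [t _ <-]; exact: set_valP.
have Gfun (F : fsym tau) (a : 'I_(farity F) -> G) :
    G (val (fint (sub_incl GM \o a))).
  have /choice[t ta] i : exists t : term A, val (eval v t) = val (a i).
    by have [t _ e] := set_valP (a i); exists t.
  exists (App t) => //=; congr (val (fint _)).
  by apply: funext => i; apply: val_inj; rewrite /= ta.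
exists (sub_structure Gfun); split; first exact: sub_structureP.
  by move=> x Ax; exists (Var (SigSub (mem_set Ax))).
apply: cle_trans (cle_term natX FX AX).
apply: (@cle_surj _ _ (fun t => SigSub (mem_set (imageT (fun t : term A =>
  val (eval v t)) t)))).
by move=> y; have [t _ e] := set_valP y; exists t; exact: val_inj.
Qed.

End Substructures.

(** * Well-orders and unions of chains *)

Lemma well_order_min (I : Small) (le : rel I) (S : set I) :
  wochoice.well_order le -> S !=set0 -> exists2 m, S m & forall x, S x ->
    le m x.
Proof.
move=> wo [x Sx].
have [|m [[/asboolP Sm minm] _]] := wo (fun y => `[< S y >]).
  by exists x; apply/asboolP.
by exists m => // y Sy; apply: minm; apply/asboolP.
Qed.

(** A well-order is given by unique minima of nonempty sets: singletons yield reflexivity, pairs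
    totality and, by uniqueness, antisymmetry, triples transitivity. *)
Lemma well_order_linear (I : Small) (le : rel I) : wochoice.well_order le ->
  [/\ forall x, le x x, forall x y, le x y -> le y x -> x = y,
      forall x y, le x y \/ le y x & forall x y z, le x y -> le y z -> le x z].
Proof.
move=> wo.
have refl x : le x x.
  by have [|m -> h] := @well_order_min _ _ [set x] wo; [exists x|exact: h].
have tot x y : le x y \/ le y x.
  have [|m [] -> h] := @well_order_min _ _ [set x; y] wo; first by exists x;
    left.
    by left; apply: h; right.
  by right; apply: h; left.
have anti x y : le x y -> le y x -> x = y.
  move=> xy yx; have [|z [_ uz]] := wo (fun w => `[< w = x \/ w = y >]).
    by exists x; apply/asboolP; left.
  transitivity z; [apply: esym|]; apply: uz.
    by split=> [|w /asboolP[] ->] //; apply/asboolP; left.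
  by split=> [|w /asboolP[] ->] //; apply/asboolP; right.
split=> // x y z xy yz.
have [|m [[] ->|->] h] := @well_order_min _ _ [set x; y; z] wo.
- by exists x; left; left.
- by apply: h; right.
- by rewrite (anti x y) //; apply: h; left; left.
- by rewrite -(anti y z) //; apply: h; left; right.
Qed.

Lemma limit_order_bound (I : Small) (le : rel I) n (k : 'I_n -> I) :
  limit_order le -> exists i, forall j, wo_lt le (k j) i.
Proof.
move=> [/well_order_linear[refl anti tot trans] [i0] nomax].
have [i ik] : exists i, forall j, le (k j) i.
  elim: n k => [|n IH] k; first by exists i0 => -[].
  have [i ik] := IH (fun j => k (lift ord0 j)).
  have [h|h] := tot i (k ord0).
    exists (k ord0) => j; case: (unliftP ord0 j) => [j' ->|-> //].
    exact: trans (ik j') h.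
  by exists i => j; case: (unliftP ord0 j) => [j' ->|-> //]; exact: ik.
have [i' [ii' ne]] := nomax i; exists i' => j; split;
  first exact: trans (ik j) ii'.
by move=> e; apply: ne; apply: anti => //; rewrite -e.
Qed.

Section Unions.
Context (tau : vocabulary).

(** The finitely many stages containing the entries have a common upper bound. This is how
    conditions on finite tuples pass to unions. *)
Lemma union_tuple (T I : Small) (le : rel I) (M : I -> structure tau T)
    (U : structure tau T) n (v : 'I_n -> U) :
  limit_order le -> (forall i j, wo_lt le i j -> substructure (M i) (M j)) ->
  union_of M U ->
  exists i (w : 'I_n -> M i), forall j, val (w j) = val (v j).
Proof.
move=> lim incr [UM _].
have /choice[k kv] j : exists i, univ (M i) (val (v j)).
  suff [i _ Mi] : (\bigcup_i univ (M i)) (val (v j)) by exists i.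
  by rewrite -UM; exact: set_valP.
have [i ki] := limit_order_bound k lim; exists i.
have Mi j : univ (M i) (val (v j)).
  exact: substructure_univ (incr _ _ (ki j)) _ (kv j).
by exists (fun j => SigSub (mem_set (Mi j))).
Qed.

Lemma union_substructure (T I : Small) (le : rel I) (M : I -> structure tau T)
    (U N : structure tau T) :
  limit_order le -> (forall i j, wo_lt le i j -> substructure (M i) (M j)) ->
  union_of M U -> (forall i, substructure (M i) N) -> substructure U N.
Proof.
move=> lim incr MU MN.
have UN : univ U `<=` univ N.
  move=> x; case: (MU) => -> _ [i _ Mix].
  exact: substructure_univ (MN i) _ Mix.
pose f (x : U) : N := SigSub (mem_set (UN _ (set_valP x))).
have lift n (a : 'I_n -> U) : exists i (w : 'I_n -> M i) (g : M i -> U)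
    (h : M i -> N), [/\ embedding g, embedding h, g \o w = a,
      h \o w = f \o a & forall x, f (g x) = h x].
  have [i [w wv]] := union_tuple a lim incr MU.
  have [_ /(_ i)[g gE gv]] := MU; have [h hE hv] := MN i.
  exists i, w, g, h; split=> //.
  - by apply: funext => j; apply: val_inj; rewrite /= gv wv.
  - by apply: funext => j; apply: val_inj; rewrite /= hv wv.
  - by move=> x; apply: val_inj; rewrite /= gv hv.
exists f; last by [].
split.
- by move=> x y /(congr1 val) /= /val_inj.
- move=> R a; have [i [w [g [h [gE hE <- hw fg]]]]] := lift _ a.
  rewrite -(embedding_rel gE w) (embedding_rel hE w) hw.
  by [].
- move=> F a; have [i [w [g [h [gE hE <- hw fg]]]]] := lift _ a.
  by rewrite -(embedding_fun gE w) fg (embedding_fun hE w) hw.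
Qed.

End Unions.

Section Universal.
Context (tau : vocabulary) (p : nat).
Variable psi : forall (T : Small) (M : structure tau T), ('I_p -> M) -> Prop.
Hypothesis psi_embedding : forall (T T' : Small) (M : structure tau T)
  (N : structure tau T') (f : M -> N) (v : 'I_p -> M),
  embedding f -> (psi v <-> psi (f \o v)).
Hypothesis rsym_countable : cle (rsym tau) nat.
Hypothesis fsym_countable : cle (fsym tau) nat.

(** [psi] acts as a quantifier-free formula, being preserved and reflected by embeddings. Such
    classes are closed under substructures and unions of chains, which yields the axioms of an AEC
    with countable Loewenheim-Skolem number. *)
Definition universal_class : abstract_class := @AbstractClass tau
  (fun T M => forall v : 'I_p -> M, psi v)
  (fun T M N => [/\ forall v : 'I_p -> M, psi v, forall v : 'I_p -> N, psi v &
     substructure M N]).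

Lemma member_embedding (T T' : Small) (M : structure tau T)
    (N : structure tau T') (f : M -> N) : embedding f ->
  @member universal_class _ N -> @member universal_class _ M.
Proof. by move=> fE NK v; apply/(psi_embedding v fE); exact: NK. Qed.

Lemma universal_class_ls_bound : ls_bound universal_class nat.
Proof.
split; first exact: infinite_nat.
  exact: cle_sum_inf (cle_refl nat) rsym_countable fsym_countable.
move=> T M A MK AM.
pose X := (A + nat)%type.
have natX : cle nat X by apply: (@cle_inj _ _ inr) => x y [].
have AX : cle A X by apply: (@cle_inj _ _ inl) => x y [].
have [N [NM AN NX]] := generated_substructure natX (cle_trans fsym_countable
  natX) AX AM.
exists N; split=> //; last first.
  by apply/card_le_cle; apply: cle_trans NX (cle_setT _).
split=> //; have [f fE _] := NM; exact: member_embedding fE MK.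
Qed.

Lemma universal_class_aec : is_aec universal_class.
Proof.
split.
- move=> T T' M N f /isomorphism_inv[g [gE _ _]]; exact: member_embedding gE.
- move=> T T' M N M' N' g f /isomorphism_inv[g' [g'E _ _]].
  move=> /isomorphism_inv[f' [f'E _ _]] MN' _ [MK NK _]; split=> //.
    exact: member_embedding g'E MK.
  exact: member_embedding f'E NK.
- by move=> T M N [].
- by move=> T M N [].
- by move=> T M MK; split=> //; exact: substructure_refl.
- move=> T M N P [MK _ MN] [_ PK NP]; split=> //;
    exact: substructure_trans MN NP.
- by move=> T M N P MN [MK _ _] [NK _ _].
- move=> T I le M U lim [MK Mincr _] MU.
  have incr i j : wo_lt le i j -> substructure (M i) (M j) by case/Mincr.
  have UK : @member universal_class _ U.
    move=> v; have [i [w wv]] := union_tuple v lim incr MU.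
    have [_ /(_ i)[f fE fv]] := MU.
    rewrite (_ : v = f \o w); last first.
      by apply: funext => j; apply: val_inj; rewrite /= fv wv.
    by apply/(psi_embedding w fE); exact: MK.
  split=> // [i|N MN]; first by split; [exact: MK|exact: UK|case: MU].
  have [i0] : inhabited I by case: lim.
  split=> //; first by case: (MN i0).
  by apply: (union_substructure lim incr MU) => i; case: (MN i).
- by exists nat; exact: universal_class_ls_bound.
Qed.

Lemma universal_class_LS : is_LS universal_class nat.
Proof.
split; first exact: universal_class_ls_bound.
by move=> X [/infiniteP natX _ _].
Qed.

(** The range of an embedding is closed under the functions, so it carries a substructure, and
    substructures of members are members. *)
Lemma strong_embeddingP (T T' : Small) (M : structure tau T)
    (N : structure tau T') (f : M -> N) :
  @member universal_class _ N -> embedding f ->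
  @strong_embedding universal_class _ _ M N f.
Proof.
move=> NK fE; have [fI fR fF] := fE.
pose G : set T' := range (val \o f).
have GN : G `<=` univ N by move=> _ [x _ <-]; exact: set_valP.
have eqf (y : G) : exists x, f x = sub_incl GN y.
  by have [x _ e] := set_valP y; exists x; exact: val_inj.
have Gfun (F : fsym tau) (a : 'I_(farity F) -> G) :
    G (val (fint (sub_incl GN \o a))).
  have /choice[b ba] i := eqf (a i).
  by exists (fint b) => //=; rewrite fF; congr (val (fint _)); apply: funext.
exists (sub_structure Gfun); split.
  have sub := sub_structureP Gfun; split=> //; have [g gE _] := sub.
  exact: member_embedding gE NK.
exists (fun x => SigSub (mem_set (imageT (val \o f) x))); last by [].
split.
  have [g gE gv] := sub_structureP Gfun.
  apply: embedding_factor fE gE _ => x; apply: val_inj.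
  by rewrite gv.
have /choice[g gK] := eqf.
exists g => x; last by apply: val_inj => /=; rewrite gK.
by apply: fI; rewrite gK; exact: val_inj.
Qed.

End Universal.

(** * A class whose models are the countable sets *)

Definition naming_voc : vocabulary :=
  @Vocabulary nat void (fun=> 1) (fun=> 0).

Definition names (T : Small) (M : structure naming_voc T) (x : M) : set nat :=
  [set n | @rint _ _ M n (fun=> x)].

(** Naming thus becomes an injection of the model into [nat]. *)
Definition naming_axiom (T : Small) (M : structure naming_voc T)
    (v : 'I_2 -> M) : Prop :=
  (exists n, names (v ord0) = [set n]) /\
  (names (v ord0) = names (v ord_max) -> v ord0 = v ord_max).

Lemma naming_axiom_embedding (T T' : Small) (M : structure naming_voc T)
    (N : structure naming_voc T') (f : M -> N) (v : 'I_2 -> M) :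
  embedding f -> (naming_axiom v <-> naming_axiom (f \o v)).
Proof.
move=> [fI fR _].
have namesE x : names (f x) = names x.
  by rewrite predeqE => n; rewrite /names /=; exact: iff_sym (fR n (fun=> x)).
rewrite /naming_axiom /= !namesE; split=> -[h1 h2]; split=> // /h2;
  first by move->.
exact: fI.
Qed.

Definition naming_class : abstract_class := universal_class naming_axiom.

Lemma naming_voc_countable : cle nat nat /\ cle void nat.
Proof. by split; [exact: cle_refl|apply/cleP; exists (fun x : void =>
  match x with end) => -[]]. Qed.

Lemma naming_class_aec : is_aec naming_class.
Proof.
by case: naming_voc_countable => *; apply: universal_class_aec => // *;
  exact: naming_axiom_embedding.
Qed.

Lemma naming_class_LS : is_LS naming_class nat.
Proof.
by case: naming_voc_countable => *; apply: universal_class_LS => // *;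
  exact: naming_axiom_embedding.
Qed.

Definition naming_structure (X : Small) (g : X -> nat) :
  structure naming_voc X :=
  @Structure naming_voc X setT (fun n a => g (val (a ord0)) = n)
    (fun F : void => match F with end).

Lemma naming_structure_member (X : Small) (g : X -> nat) : injective g ->
  @member naming_class _ (naming_structure g).
Proof.
move=> gI v.
have namesE x : @names _ (naming_structure g) x = [set g (val x)].
  by rewrite predeqE => n; split=> /= ->.
split; first by rewrite namesE; eexists.
rewrite !namesE => /predeqP /(_ (g (val (v ord0)))) /= [] /(_ erefl) /gI e _.
exact: val_inj.
Qed.

(** Sending a point to its name embeds every model into [nat], where each number names itself. *)
Lemma naming_JEP (lambda : Small) : cle lambda nat -> JEP naming_class lambda.
Proof.
move=> /cleP[g gI]; split.
  exists lambda, (naming_structure g); split; first exact: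
    naming_structure_member.
  by rewrite card_eqxx.
pose N := naming_structure (@id nat).
have NK : @member naming_class _ N by exact: naming_structure_member.
have emb (T : Small) (M : structure naming_voc T) : @member naming_class _ M ->
    exists f : M -> N, @strong_embedding naming_class _ _ M N f.
  move=> MK.
  have /choice[h hE] (x : M) : exists n, names x = [set n].
    by have [] := MK (fun=> x).
  exists (fun x => SigSub (in_setT (h x))).
  apply: strong_embeddingP => //.
    by move=> *; exact: naming_axiom_embedding.
  split=> [x y [e]|n a|[]]; last first.
    have -> : a = fun=> a ord0 by apply: funext => i; rewrite (ord1 i).
    have := hE (a ord0) => /predeqP/(_ n) [h1 h2].
    by split=> [/h1 ->|] //= hn; exact/h2/esym.
  have [_] := MK (fun i => if i == ord0 then x else y).
  by rewrite /= !hE e; exact.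
move=> T0 T1 M0 M1 /emb[f0 f0E] _ /emb[f1 f1E] _.
by exists nat, N, f0, f1.
Qed.

(** Models are countable, so it is the existence of a model of size [lambda] that fails. *)
Lemma naming_not_JEP (lambda : Small) : ~ cle lambda nat ->
  ~ JEP naming_class lambda.
Proof.
move=> nl [[T [M [MK /card_eq_cle[_ lM]]]] _]; apply: nl.
apply: cle_trans lM _.
have /choice[h hE] (x : M) : exists n, names x = [set n].
  by have [] := MK (fun=> x).
apply: (cle_inj (f := h)) => x y e.
have [_] := MK (fun i => if i == ord0 then x else y).
by rewrite /= !hE e; exact.
Qed.

(** * Bubbles *)

(** Intended reading: [bval f x] is the value of [f] at [x]; [bimp f g k l] declares that on level 0
    [g] is [l] wherever [f] is [k]; [biso x f] declares that [f] has no zero on level 0 other than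
    [x]; [bdif] is a Skolem function for extensionality, which keeps the axioms universal. *)
Record bubble (I : Small) := Bubble {
  blev : I -> nat;
  bval : I -> I -> nat;
  bimp : I -> I -> nat -> nat -> Prop;
  biso : I -> I -> Prop;
  bdif : I -> I -> I }.

(* [bimp] and [biso] are constraints, not equivalences: they may fail to record
   a true implication, so new functions can be added without any closure
   condition. *)
Record bubble_ok (L : set nat) (I : Small) (b : bubble I) : Prop := {
  blevP : forall x, L (blev b x);
  bimpP : forall f g k l, bimp b f g k l ->
    forall x, blev b x = 0 -> bval b f x = k -> bval b g x = l;
  bisoP : forall x f, biso b x f ->
    forall y, blev b y = 0 -> bval b f y = 0 -> y = x;
  bdifP : forall f g n, blev b f = n.+1 -> blev b g = n.+1 -> f <> g ->
    blev b (bdif b f g) = n /\ bval b f (bdif b f g) <> bval b g (bdif b f g) }.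

Record bubble_embedding (I J : Small) (f : I -> J) (b : bubble I)
    (b' : bubble J) : Prop := {
  bemb_lev : forall x, blev b' (f x) = blev b x;
  bemb_val : forall x y, bval b' (f x) (f y) = bval b x y;
  bemb_imp : forall x y, bimp b' (f x) (f y) = bimp b x y;
  bemb_iso : forall x y, biso b' (f x) (f y) = biso b x y;
  bemb_dif : forall x y, bdif b' (f x) (f y) = f (bdif b x y) }.

Definition level (I : Small) (b : bubble I) (n : nat) : set I :=
  [set x | blev b x = n].

Lemma level_ext (L : set nat) (I : Small) (b : bubble I) n : bubble_ok L b ->
  cle (level b n.+1) (level b n -> nat).
Proof.
move=> ok; apply: (@cle_inj _ _ (fun f x => bval b (val f) (val x))) =>
  f g /funeqP e.
apply: contrapT => fg.
have [d ne] := bdifP ok (set_valP f) (set_valP g) (fun e => fg (val_inj e)).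
by apply: ne; exact: e (SigSub (mem_set d)).
Qed.

(** At most [kappa] functions on level [n] are realized, out of more than [kappa], so enough
    unrealized ones remain to turn every point of [J] outside the range of [f] into a new function
    of level [n.+1]. *)
Lemma bubble_extension (L : set nat) (kappa I J : Small) (b : bubble I)
    (f : I -> J) n :
  bubble_ok L b -> injective f -> cle nat kappa -> cle I kappa -> cle J kappa ->
  L n.+1 -> ~ cle (level b n -> nat) kappa ->
  exists2 b', bubble_ok L b' & bubble_embedding f b b'.
Proof.
move=> ok fI natk Ik Jk Ln big.
pose row a (x : level b n) := bval b a (val x).
pose R : set (level b n -> nat) := [set row a | a in level b n.+1].
have Rk : cle R kappa.
  apply: cle_trans Ik.
  have /choice[a aP] (g : R) : exists a, row a = val g.
    by have [a _ e] := set_valP g; exists a.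
  by apply: (cle_inj (f := a)) => g h e; apply: val_inj; rewrite -!aP e.
have /cleP[G GI] : cle J (~` R).
  have [//|RJ] := cle_total J (~` R); exfalso; apply: big.
  apply: cle_trans (cle_setC R) _; apply: cle_sum_inf => //.
  exact: cle_trans RJ Jk.
have GR y a : blev b a = n.+1 -> row a <> val (G y).
  by move=> an e; apply: (set_valP (G y)); exists a.
have [r rP] := partial_inverse f.
have rf x : r (f x) = Some x.
  by case: (r (f x)) (rP (f x)) => [x' /fI ->|/(_ x)].
(* New points never enter level 0, so [bimp] and [biso] between old functions concern the same
   points as before. *)
pose lev' y := if r y is Some x then blev b x else n.+1.
(* A new function takes its row [G y] on level [n]; all other values involving a new point default
   to 0. *)
pose val' y z := match r y, r z with
  | Some x, Some w => bval b x w
  | None, Some w => if pselect (level b n w) is left h then val (G y) (SigSub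
    (mem_set h)) else 0
  | _, None => 0 end.
(* Old pairs keep their witness. Otherwise the two rows on level [n] differ, since the rows [G] are
   pairwise distinct and unrealized, and an old point where they differ serves. *)
have /choice[d dP] (yz : J * J) : exists d, 
    match r yz.1, r yz.2 with Some x, Some w => d = f (bdif b x w)
    | _, _ => forall m, lev' yz.1 = m.+1 -> lev' yz.2 = m.+1 -> yz.1 <> yz.2 ->
      lev' d = m /\ val' yz.1 d <> val' yz.2 d end.
  case: yz => y z /=.
  case ry: (r y) => [x|]; case rz: (r z) => [w|]; first by eexists.
  - have [[wn yz]|no] := pselect (blev b x = n.+1 /\ y <> z); last first.
      exists y => m; rewrite /lev' ry rz => xm [nm] yz.
      by case: no; rewrite nm.
    have [u ne] : exists u, row x u <> val (G z) u.
      apply: contrapT => h; apply: (GR z _ wn); apply: funext => u.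
      by apply: contrapT => h'; apply: h; exists u.
    exists (f (val u)) => m; rewrite /lev' ry rz => _ [<-] _.
    rewrite rf; split; first exact: (set_valP u).
    rewrite /val' ry rz rf; case: pselect => [h|]; last by case;
      exact: (set_valP u).
    by rewrite (_ : SigSub _ = u) //; exact: val_inj.
  - have [[wn yz]|no] := pselect (blev b w = n.+1 /\ y <> z); last first.
      exists y => m; rewrite /lev' ry rz => -[nm] xm yz.
      by case: no; rewrite nm.
    have [u ne] : exists u, row w u <> val (G y) u.
      apply: contrapT => h; apply: (GR y _ wn); apply: funext => u.
      by apply: contrapT => h'; apply: h; exists u.
    exists (f (val u)) => m; rewrite /lev' ry rz => -[<-] _ _.
    rewrite rf; split; first exact: (set_valP u).
    rewrite /val' ry rz rf; case: pselect => [h|]; last by case;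
      exact: (set_valP u).
    by rewrite (_ : SigSub _ = u) //; [exact: nesym|exact: val_inj].
  - have [yz|yz] := pselect (y = z); first by exists y => m _ _ /(_ yz).
    have [u ne] : exists u, val (G y) u <> val (G z) u.
      apply: contrapT => h; apply: yz; apply: GI; apply: val_inj.
      by apply: funext => u; apply: contrapT => h'; apply: h; exists u.
    exists (f (val u)) => m; rewrite /lev' ry rz => -[<-] _ _.
    rewrite rf; split; first exact: (set_valP u).
    rewrite /val' ry rz rf; case: pselect => [h|]; last by case;
      exact: (set_valP u).
    by rewrite (_ : SigSub _ = u) //; exact: val_inj.
pose imp' y z := match r y, r z with Some x, Some w => bimp b x w | _, _ =>
  fun _ _ => False end.
pose iso' y z := match r y, r z with Some x, Some w => biso b x w | _, _ =>
  False end.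
exists (Bubble lev' val' imp' iso' (fun y z => d (y, z))); last first.
  split=> [x|x y|x y|x y|x y] /=; rewrite /lev' /val' /imp' /iso' ?rf //.
  by have := dP (f x, f y); rewrite /= !rf.
split=> /=.
- by move=> y; rewrite /lev'; case: (r y) => [x|//]; exact: blevP ok x.
- move=> y z k l; rewrite /imp' /val' /lev'.
  case: (r y) => [x|//]; case: (r z) => [w|//] h u.
  by case: (r u) => [v|//]; exact: (bimpP ok h).
- move=> y z; rewrite /iso' /val' /lev'.
  case: (r y) (rP y) => [x <-|//]; case: (r z) => [w|//] h u.
  by case: (r u) (rP u) => [v <-|//] v0 e; congr f; exact: (bisoP ok h).
- move=> y z m ym zm yz; have := dP (y, z) => /=.
  case ry: (r y) (rP y) ym => [x|] yx ym; case rz: (r z) (rP z) zm =>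
    [w|] zw zm; try by apply.
  move=> ->; move: ym zm; rewrite /lev' ry rz rf => xm wm.
  rewrite /val' ry rz rf; apply: bdifP ok _ _ _ xm wm _.
  by move=> xw; apply: yz; rewrite -yx -zw xw.
Qed.

(** * Bubbles as first-order structures *)

Inductive bubble_sym : Small :=
| Color | Lev of nat | Val of nat | Imp of nat & nat | Iso.

(* The first argument of every symbol but [Color] names the bubble. *)
Definition bubble_voc : vocabulary := @Vocabulary bubble_sym unit
  (fun R => match R with Color => 1 | Lev _ => 2 | _ => 3 end) (fun=> 3).

Definition tup1 (T : Type) (x : T) (i : 'I_1) := x.
Definition tup2 (T : Type) (x y : T) (i : 'I_2) :=
  if i == ord0 then x else y.
Definition tup3 (T : Type) (x y z : T) (i : 'I_3) :=
  if i == ord0 then x else if i == ord_max then z else y.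
Definition tup4 (T : Type) (x y z w : T) (i : 'I_4) :=
  if i == ord0 then x else if i == ord_max then w
  else if i == inord 1 then y else z.

Lemma tup1E (T : Type) (a : 'I_1 -> T) : a = tup1 (a ord0).
Proof. by apply: funext => i; rewrite (ord1 i). Qed.

Lemma tup2E (T : Type) (a : 'I_2 -> T) : a = tup2 (a ord0) (a ord_max).
Proof.
apply: funext => -[[|[|//]] lt]; rewrite /tup2 /=; congr a; exact: val_inj.
Qed.

Lemma tup3E (T : Type) (a : 'I_3 -> T) :
  a = tup3 (a ord0) (a (inord 1)) (a ord_max).
Proof.
apply: funext => -[[|[|[|//]]] lt]; rewrite /tup3 /=; congr a;
  apply: val_inj => //=.
by rewrite inordK.
Qed.

Lemma comp_tup1 (T T' : Type) (f : T -> T') x : f \o tup1 x = tup1 (f x).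
Proof. by []. Qed.

Lemma comp_tup2 (T T' : Type) (f : T -> T') x y :
  f \o tup2 x y = tup2 (f x) (f y).
Proof. by apply: funext => i; rewrite /tup2 /=; case: ifP. Qed.

Lemma comp_tup3 (T T' : Type) (f : T -> T') x y z :
  f \o tup3 x y z = tup3 (f x) (f y) (f z).
Proof. by apply: funext => i; rewrite /tup3 /=; do 2?case: ifP. Qed.

Section Atoms.
Context (T : Small) (M : structure bubble_voc T).

Definition color (x : M) : Prop := @rint _ _ M Color (tup1 x).
Definition levels (i x : M) : set nat := fun n =>
  @rint _ _ M (Lev n) (tup2 i x).
Definition values (i f x : M) : set nat :=
  fun k => @rint _ _ M (Val k) (tup3 i f x).
Definition implies (i f g : M) : nat -> nat -> Prop :=
  fun k l => @rint _ _ M (Imp k l) (tup3 i f g).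
Definition isolates (i x f : M) : Prop := @rint _ _ M Iso (tup3 i x f).
Definition differ (i f g : M) : M := @fint _ _ M tt (tup3 i f g).

Definition describes (i : M) (b : bubble M) : Prop := [/\
  forall x, levels i x = [set blev b x],
  forall f x, values i f x = [set bval b f x],
  forall f g, implies i f g = bimp b f g,
  forall x f, isolates i x f = biso b x f &
  forall f g, differ i f g = bdif b f g].

End Atoms.

Section AtomsEmbedding.
Context (T T' : Small) (M : structure bubble_voc T) (N :
  structure bubble_voc T')
  (f : M -> N).
Hypothesis fE : embedding f.

Lemma color_emb x : color (f x) = color x.
Proof.
by apply: propext; apply: iff_sym; exact: (embedding_rel fE (R :=
  Color) (tup1 x)).
Qed.

Lemma levels_emb i x : levels (f i) (f x) = levels i x.
Proof.
apply: funext => n; apply: propext; apply: iff_sym.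
by rewrite /levels -comp_tup2; exact: (embedding_rel fE (R := Lev n)).
Qed.

Lemma values_emb i x y : values (f i) (f x) (f y) = values i x y.
Proof.
apply: funext => n; apply: propext; apply: iff_sym.
by rewrite /values -comp_tup3; exact: (embedding_rel fE (R := Val n)).
Qed.

Lemma implies_emb i x y : implies (f i) (f x) (f y) = implies i x y.
Proof.
apply: funext => k; apply: funext => l; apply: propext; apply: iff_sym.
by rewrite /implies -comp_tup3; exact: (embedding_rel fE (R := Imp k l)).
Qed.

Lemma isolates_emb i x y : isolates (f i) (f x) (f y) = isolates i x y.
Proof.
apply: propext; apply: iff_sym.
by rewrite /isolates -comp_tup3; exact: (embedding_rel fE (R := Iso)).
Qed.

Lemma differ_emb i x y : differ (f i) (f x) (f y) = f (differ i x y).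
Proof.
by rewrite /differ -comp_tup3; apply: esym; exact: (embedding_fun fE (F := tt)).
Qed.

Lemma embedding_describes i b b' : describes i b -> describes (f i) b' ->
  bubble_embedding f b b'.
Proof.
move=> [bl bv bi bs bd] [bl' bv' bi' bs' bd']; split.
- move=> x; have := levels_emb i x; rewrite bl bl' =>
    /predeqP/(_ (blev b x))[_].
  by move=> /(_ erefl) ->.
- move=> x y; have := values_emb i x y; rewrite bv bv' =>
    /predeqP/(_ (bval b x y))[_].
  by move=> /(_ erefl) ->.
- by move=> x y; rewrite -bi' -bi implies_emb.
- by move=> x y; rewrite -bs' -bs isolates_emb.
- by move=> x y; rewrite -bd' -bd differ_emb.
Qed.

End AtomsEmbedding.

Lemma describes_embedding (T T' : Small) (M : structure bubble_voc T)
    (N : structure bubble_voc T') (f : M -> N) (b : M -> bubble M)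
    (b' : N -> bubble N) : injective f -> (forall x, color (f x) = color x) ->
  (forall i, describes i (b i)) -> (forall i, describes i (b' i)) ->
  (forall i, bubble_embedding f (b i) (b' (f i))) -> embedding f.
Proof.
move=> fI fc bD bD' bE; split=> //.
- case=> [|n|k|k l|] a /=.
  + rewrite (tup1E a) comp_tup1 -/(color _) -/(color _) fc //.
  + rewrite (tup2E a) comp_tup2 -/(levels _ _ n) -/(levels _ _ n).
    have [-> _ _ _ _] := bD (a ord0); have [-> _ _ _ _] := bD' (f (a ord0)).
    by rewrite (bemb_lev (bE _)).
  + rewrite (tup3E a) comp_tup3 -/(values _ _ _ k) -/(values _ _ _ k).
    have [_ -> _ _ _] := bD (a ord0); have [_ -> _ _ _] := bD' (f (a ord0)).
    by rewrite (bemb_val (bE _)).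
  + rewrite (tup3E a) comp_tup3 -/(implies _ _ _ k l) -/(implies _ _ _ k l).
    have [_ _ -> _ _] := bD (a ord0); have [_ _ -> _ _] := bD' (f (a ord0)).
    by rewrite (bemb_imp (bE _)).
  + rewrite (tup3E a) comp_tup3 -/(isolates _ _ _) -/(isolates _ _ _).
    have [_ _ _ -> _] := bD (a ord0); have [_ _ _ -> _] := bD' (f (a ord0)).
    by rewrite (bemb_iso (bE _)).
- case=> a; rewrite (tup3E a) comp_tup3 -/(differ _ _ _) -/(differ _ _ _).
  have [_ _ _ _ ->] := bD (a ord0); have [_ _ _ _ ->] := bD' (f (a ord0)).
  by rewrite (bemb_dif (bE _)).
Qed.

Definition bubble_structure (T : Small) (A : set T) (c : A -> Prop)
    (b : A -> bubble A) : structure bubble_voc T :=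
  @Structure bubble_voc T A
    (fun R => match R with
      | Color => fun a => c (a ord0)
      | Lev n => fun a => blev (b (a ord0)) (a ord_max) = n
      | Val k => fun a => bval (b (a ord0)) (a (inord 1)) (a ord_max) = k
      | Imp k l => fun a => bimp (b (a ord0)) (a (inord 1)) (a ord_max) k l
      | Iso => fun a => biso (b (a ord0)) (a (inord 1)) (a ord_max)
      end)
    (fun _ a => bdif (b (a ord0)) (a (inord 1)) (a ord_max)).

Lemma tup3_1 (T : Type) (x y z : T) : tup3 x y z (inord 1) = y.
Proof. by rewrite /tup3 -!val_eqE /= inordK. Qed.

Lemma bubble_structure_describes (T : Small) (A : set T) (c : A -> Prop)
    (b : A -> bubble A) i : @describes _ (bubble_structure c b) i (b i).
Proof.
split=> *; rewrite /levels /values /implies /isolates /differ /= ?tup3_1 //.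
- by rewrite predeqE => n; split=> /= ->.
- by rewrite predeqE => n; rewrite ?tup3_1; split=> /= ->.
Qed.

Section BubbleClass.
Variable L : set nat.

(** [bubble_ok] for the bubble of [i], without quantifiers over the model, as [universal_class]
    requires; the first two clauses make level and value functions. *)
Definition bubble_axiom (T : Small) (M : structure bubble_voc T)
    (v : 'I_4 -> M) : Prop :=
  let i := v ord0 in let x := v (inord 1) in let y := v (inord 2) in
  let z := v ord_max in [/\
  exists2 n, L n & levels i x = [set n],
  exists k, values i x y = [set k],
  forall k l, implies i x y k l ->
    levels i z 0 -> values i x z k -> values i y z l,
  isolates i x y -> levels i z 0 -> values i y z 0 -> z = x &
  forall n, levels i x n.+1 -> levels i y n.+1 -> x <> y ->
    levels i (differ i x y) n /\
    values i x (differ i x y) <> values i y (differ i x y)].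

Lemma bubble_axiom_embedding (T T' : Small) (M : structure bubble_voc T)
    (N : structure bubble_voc T') (f : M -> N) (v : 'I_4 -> M) :
  embedding f -> (bubble_axiom v <-> bubble_axiom (f \o v)).
Proof.
move=> fE; have fI := embedding_inj fE.
have eqf (x y : M) : (f x = f y) = (x = y).
  by apply: propext; split=> [/fI|->].
by rewrite /bubble_axiom /= !(levels_emb fE, values_emb fE, implies_emb fE,
  isolates_emb fE, differ_emb fE, eqf).
Qed.

Definition bubble_class : abstract_class := universal_class bubble_axiom.

Lemma bubble_class_memberP (T : Small) (M : structure bubble_voc T) :
  @member bubble_class _ M <->
  exists b : M -> bubble M, forall i, bubble_ok L (b i) /\ describes i (b i).
Proof.
split=> [MK|[b bP] v]; last first.
  have [[bL bI bS bD] [bl bv bi bs bd]] := bP (v ord0).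
  rewrite /bubble_axiom !bl !bv !bi !bs !bd; split.
  - by eexists => //; exact: bL.
  - by eexists.
  - by move=> k l /bI h /esym/h{}h /esym/h /= ->.
  - by move=> /bS h /esym/h{}h /esym/h.
  - move=> n /esym xn /esym yn xy.
    have [<- ne] := bD _ _ _ xn yn xy; split=> //.
    by move=> /predeqP e; apply: ne; exact: ((e _).1 erefl).
have t4 (i x y z : M) : [/\ tup4 i x y z ord0 = i, tup4 i x y z (inord 1) = x,
    tup4 i x y z (inord 2) = y & tup4 i x y z ord_max = z].
  by split; rewrite /tup4 -?val_eqE /= ?inordK.
have ax i x y z : bubble_axiom (tup4 i x y z) := MK (tup4 i x y z).
suff /choice[b bP] i : exists b, bubble_ok L b /\ @describes _ M i b by exists
  b.
have /choice[l lP] (x : M) : exists n, L n /\ levels i x = [set n].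
  have := ax i x x x; rewrite /bubble_axiom; have [-> -> -> ->] := t4 i x x x.
  by move=> [[n Ln e] _ _ _ _]; exists n.
have /choice[u uP] (xy : M * M) : exists k, values i xy.1 xy.2 = [set k].
  case: xy => x y /=.
  have := ax i x y x; rewrite /bubble_axiom; have [-> -> -> ->] := t4 i x y x.
  by move=> [_ [k e] _ _ _]; exists k.
exists (Bubble l (fun x y => u (x, y)) (implies i) (isolates i) (differ i)).
have lE x : levels i x = [set l x] by case: (lP x).
have uE x y : values i x y = [set u (x, y)] by exact: (uP (x, y)).
split; last by split.
split=> /=.
- by move=> x; case: (lP x).
- move=> f g k m h x xl xv.
  have := ax i f g x; rewrite /bubble_axiom; have [-> -> -> ->] := t4 i f g x.
  by move=> [_ _ /(_ _ _ h) + _ _]; rewrite lE !uE /= xl xv => /(_ erefl erefl).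
- move=> x f h y yl yv.
  have := ax i x f y; rewrite /bubble_axiom; have [-> -> -> ->] := t4 i x f y.
  by move=> [_ _ _ /(_ h) + _]; rewrite lE !uE /= yl yv; apply.
- move=> f g n fn gn fg.
  have := ax i f g f; rewrite /bubble_axiom; have [-> -> -> ->] := t4 i f g f.
  move=> [_ _ _ _ /(_ n)]; rewrite !lE !uE /= fn gn => /(_ erefl erefl fg) [->
    ne].
  by split=> // e; apply: ne; rewrite e.
Qed.

Lemma bubble_voc_countable : cle (rsym bubble_voc) nat /\ cle (fsym bubble_voc)
  nat.
Proof.
split; last by apply: (@cle_inj _ _ (fun=> 0)) => -[] [].
apply: (@cle_inj _ _ (fun R => pickle (match R with Color => (0, 0, 0)
  | Lev n => (1, n, 0) | Val n => (2, n, 0) | Imp k l => (3, k, l)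
  | Iso => (4, 0, 0) end))).
by move=> [|n|n|n n'|] [|m|m|m m'|] /(pcan_inj pickleK) //= [] => [->|->|-> ->].
Qed.

Lemma bubble_class_aec : is_aec bubble_class.
Proof.
by case: bubble_voc_countable => *; apply: universal_class_aec => // *;
  exact: bubble_axiom_embedding.
Qed.

Lemma bubble_class_LS : is_LS bubble_class nat.
Proof.
by case: bubble_voc_countable => *; apply: universal_class_LS => // *;
  exact: bubble_axiom_embedding.
Qed.

(** On the disjoint union of two models each bubble takes in the points of the other model by
    [bubble_extension]. Bubbles of different points are independent, so no compatibility has to be
    checked. *)
Lemma bubble_class_JEP (kappa : Small) : cle nat kappa -> L 0 ->
  (forall (I : Small) (b : bubble I), bubble_ok L b -> cle I kappa ->
     cle kappa I -> exists2 n, L n.+1 & ~ cle (level b n -> nat) kappa) ->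
  JEP bubble_class kappa.
Proof.
move=> natk L0 room; split.
  (* With all points on level 0, extensionality holds vacuously. *)
  pose b := @Bubble [set: kappa] (fun=> 0) (fun _ _ => 0) (fun _ _ _ _ => False)
    (fun _ _ => False) (fun x _ => x).
  exists kappa, (bubble_structure (fun=> False) (fun=> b)).
  split; last by rewrite card_eqxx.
  apply/bubble_class_memberP; exists (fun=> b) => i.
  by split; [split|exact: bubble_structure_describes].
move=> T0 T1 M0 M1 /bubble_class_memberP[b0 b0P] /card_eq_cle[M0k kM0].
move=> /bubble_class_memberP[b1 b1P] /card_eq_cle[M1k kM1].
pose W := (M0 + M1)%type.
have Wk : cle [set: W] kappa.
  by apply: cle_trans (cle_inj val_inj) _; exact: cle_sum_inf.
pose g0 (x : M0) : [set: W] := SigSub (in_setT (inl x)).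
pose g1 (x : M1) : [set: W] := SigSub (in_setT (inr x)).
have g0I : injective g0 by move=> x y [].
have g1I : injective g1 by move=> x y [].
have /choice[b bP] (i : [set: W]) : exists b : bubble [set: W], bubble_ok L b /\
    match val i with
    | inl x => bubble_embedding g0 (b0 x) b
    | inr x => bubble_embedding g1 (b1 x) b end.
  case: (val i) => x.
    have [ok _] := b0P x; have [n Ln big] := room _ _ ok M0k kM0.
    by have [b bok bE] := bubble_extension ok g0I natk M0k Wk Ln big; exists b.
  have [ok _] := b1P x; have [n Ln big] := room _ _ ok M1k kM1.
  by have [b bok bE] := bubble_extension ok g1I natk M1k Wk Ln big; exists b.
pose c (i : [set: W]) := match val i with inl x => color x | inr x =>
  color x end.
pose N := bubble_structure c b.
have NK : @member bubble_class _ N.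
  apply/bubble_class_memberP; exists b => i; split; first by case: (bP i).
  exact: bubble_structure_describes.
exists W, N, g0, g1; split=> //; apply: strong_embeddingP => //.
- by move=> *; exact: bubble_axiom_embedding.
- apply: (@describes_embedding _ _ _ N _ b0 b) => //.
  + by move=> i; case: (b0P i).
  + exact: bubble_structure_describes.
  + by move=> i; case: (bP (g0 i)).
- by move=> *; exact: bubble_axiom_embedding.
- apply: (@describes_embedding _ _ _ N _ b1 b) => //.
  + by move=> i; case: (b1P i).
  + exact: bubble_structure_describes.
  + by move=> i; case: (bP (g1 i)).
Qed.

End BubbleClass.

(** * Full towers are maximal below the first measurable cardinal *)

Definition zero_on (X : Small) (S : set X) (x : X) : nat :=
  if `[< S x >] then 0 else 1.

Lemma zero_on_in (X : Small) (S : set X) x : S x -> zero_on S x = 0.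
Proof. by rewrite /zero_on; case: asboolP. Qed.

Lemma zero_on_out (X : Small) (S : set X) x : ~ S x -> zero_on S x = 1.
Proof. by rewrite /zero_on; case: asboolP. Qed.

Lemma zero_on0 (X : Small) (S : set X) x : (zero_on S x = 0) = S x.
Proof. by apply: propext; rewrite /zero_on; case: asboolP. Qed.

(* The zero sets of the functions killed by [phi] form a countably complete
   ultrafilter, which [phi_iso] makes nonprincipal. *)
Lemma no_free_evaluation (mu X : Small) (phi : (X -> nat) -> nat) :
  first_measurable mu ->
  (forall h h' k l, (forall x, h x = k -> h' x = l) -> phi h = k ->
    phi h' = l) ->
  (forall x, phi (zero_on [set x]) <> 0) ->
  cle mu X.
Proof.
move=> mumeas imp phi_iso.
pose U : set_system X := [set S | phi (zero_on S) = 0].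
have Uup S S' : S `<=` S' -> U S -> U S'.
  move=> SS'; apply: (imp (zero_on S) (zero_on S') 0 0) => x;
    rewrite zero_on0 => Sx.
  by apply: zero_on_in; exact: SS'.
have Uno S : U S -> ~ U (~` S).
  move=> US UnS; have : phi (zero_on (~` S)) = 1.
    apply: (imp (zero_on S) _ 0 1) US => x; rewrite zero_on0 => Sx;
      by apply: zero_on_out; exact.
  by rewrite UnS.
have Uor S : U S \/ U (~` S).
  have [US|US] := pselect (U S); [by left|right].
  (* The value of [zero_on S] under [phi] is not 0, and wherever [zero_on S] takes that value the
     point is outside [S]. *)
  apply: (imp (zero_on S) _ (phi (zero_on S)) 0) => // x e.
  by apply: zero_on_in => Sx; apply: US; rewrite /U /= -e zero_on_in.
have UT : U setT by case: (Uor setT) => //; apply: Uup.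
have Uc (A : nat -> set X) : (forall n, U (A n)) -> U (\bigcap_n A n).
  move=> UA.
  (* [f] is 0 on the intersection and elsewhere is [n.+1] for some [A n] missing the point. If
     [phi f] were [n.+1], the complement of [A n] would be large. *)
  have /choice[f fP] x : exists k, match k with 0 => (\bigcap_n A n) x | n.+1 =>
    ~ A n x end.
    have [h|h] := pselect ((\bigcap_n A n) x); first by exists 0.
    apply: contrapT => h'; apply: h => n _; apply: contrapT => An.
    by apply: h'; exists n.+1.
  case fk: (phi f) => [|n].
    apply: (imp f _ 0 0) fk => x fx; apply: zero_on_in.
    by have := fP x; rewrite fx.
  case: (Uno _ (UA n)).
  apply: (imp f _ n.+1 0) fk => x fx; apply: zero_on_in.
  by have := fP x; rewrite fx.
have UF : ProperFilter U.
  split; first by move=> U0; apply: (Uno _ U0); rewrite setC0.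
  split=> // P Q UP UQ.
  apply: Uup (Uc (fun n => if n is 0 then P else Q) _) => [x h|[|n]] //.
  by split; [exact: (h 0)|exact: (h 1)].
apply: measurable_le_complete_ultrafilter mumeas _ phi_iso Uc.
split=> // G GG UG; rewrite predeqE => S; split=> [GS|/UG//].
case: (Uor S) => // /UG GnS.
by case: (@filter_not_empty _ G _); rewrite -(setICr S); exact: filterI.
Qed.

Section Tower.
Variables (X : Small) (L : set nat).
Hypothesis L0 : L 0.
Hypothesis L1 : L 1.
Hypothesis Lpred : forall n, L n.+1 -> L n.

Fixpoint tower (n : nat) : Small :=
  match n with 0 => X | n.+1 => tower n -> nat end.

(* The value is [0] unless the levels are consecutive. *)
Definition tower_val (f x : {n & tower n}) : nat :=
  match f with
  | existT 0 _ => 0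
  | existT n.+1 h =>
    if pselect (tag x = n) is left e then h (eq_rect _ tower (tagged x) _ e)
      else 0
  end.

Arguments tower_val : simpl never.

Lemma tower_valE n (h : tower n.+1) (x : tower n) :
  tower_val (existT tower n.+1 h) (existT tower n x) = h x.
Proof.
by rewrite /tower_val /=; case: pselect => [e|//]; rewrite (eq_axiomK e).
Qed.

Definition tower_set : set {n & tower n} := [set w | L (tag w)].

Definition elt n (Ln : L n) (x : tower n) : tower_set :=
  SigSub (mem_set (Ln : tower_set (existT tower n x))).

Lemma eltP (w : tower_set) n : tag (val w) = n ->
  forall Ln : L n, exists x, w = elt Ln x.
Proof.
case: w => -[m x] wL /= e Ln; case: _ / e Ln => Ln.
by exists x; exact: val_inj.
Qed.

Lemma tower_dif : exists d : tower_set -> tower_set -> tower_set,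
  forall f g n, tag (val f) = n.+1 -> tag (val g) = n.+1 -> f <> g ->
    tag (val (d f g)) = n /\
    tower_val (val f) (val (d f g)) <> tower_val (val g) (val (d f g)).
Proof.
have /choice[d dP] (fg : tower_set * tower_set) : exists d : tower_set,
    forall n, tag (val fg.1) = n.+1 -> tag (val fg.2) = n.+1 -> fg.1 <> fg.2 ->
    tag (val d) = n /\
    tower_val (val fg.1) (val d) <> tower_val (val fg.2) (val d).
  case: fg => f g /=.
  have [[n [fn gn fg]]|no] := pselect (exists n,
      [/\ tag (val f) = n.+1, tag (val g) = n.+1 & f <> g]); last first.
    by exists f => n fn gn fg; case: no; exists n.
  have LSn : L n.+1 by rewrite -fn; exact: (set_valP f).
  have [h fh] := eltP fn LSn; have [h' gh'] := eltP gn LSn.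
  have [x hx] : exists x, h x <> h' x.
    apply: contrapT => H; apply: fg; rewrite fh gh'; congr elt.
    by apply: funext => x; apply: contrapT => hx; apply: H; exists x.
  exists (elt (Lpred LSn) x) => m; rewrite fn => -[<-] _ _; split=> //.
  by rewrite fh gh' /= !tower_valE.
by exists (fun f g => d (f, g)) => f g n; exact: dP (f, g) n.
Qed.

(** [bimp] and [biso] record all true instances here, so every extension must respect them; this
    constrains evaluation at a new point. *)
Definition tower_bubble : bubble tower_set :=
  @Bubble tower_set (fun x => tag (val x)) (fun f x =>
    tower_val (val f) (val x))
    (fun f g k l => forall x : tower_set, tag (val x) = 0 ->
       tower_val (val f) (val x) = k -> tower_val (val g) (val x) = l)
    (fun x f => forall y : tower_set, tag (val y) = 0 ->
       tower_val (val f) (val y) = 0 -> y = x)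
    (projT1 (cid tower_dif)).

Lemma tower_bubble_ok : bubble_ok L tower_bubble.
Proof.
split=> //= [x|f g n]; first exact: (set_valP x).
by case: (cid tower_dif) => d /= dP; exact: dP.
Qed.

(** Induction on the level of [y]: once level [n] has no new points, a function of level [n.+1]
    agrees with an old one and extensionality applies. At level 0, evaluation at a new point would
    be forbidden by [no_free_evaluation]. *)
Lemma tower_bubble_maximal (mu J : Small) (b : bubble J) (f : tower_set -> J) :
  first_measurable mu -> ~ cle mu X -> bubble_ok L b ->
  bubble_embedding f tower_bubble b -> forall y, exists w, f w = y.
Proof.
move=> mumeas muX ok fE y.
have [n yn] : exists n, blev b y = n by eexists.
elim: n y yn => [|n IH] y yn; last first.
  have LSn : L n.+1 by rewrite -yn; exact: blevP ok y.
  pose h x := bval b y (f (elt (Lpred LSn) x)).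
  exists (elt LSn h); apply: contrapT => ne.
  have [] := bdifP ok (bemb_lev fE (elt LSn h) : _ = n.+1) yn ne.
  set d := bdif _ _ _ => dn; have [w wd] := IH _ dn; rewrite -wd.
  have wn : tag (val w) = n by rewrite -dn -wd (bemb_lev fE).
  have [x ->] := eltP wn (Lpred LSn); apply.
  by rewrite (bemb_val fE) /= tower_valE.
apply: contrapT => ynew; apply: muX.
pose phi (h : X -> nat) := bval b (f (elt (n := 1) L1 h)) y.
apply: (@no_free_evaluation mu X phi) => //.
- move=> h h' k l hh'; rewrite /phi => hk.
  apply: (bimpP ok _ yn hk); rewrite (bemb_imp fE) /= => w /eltP/(_ L0)[x ->].
  by rewrite /= !(tower_valE (n := 0)); exact: hh'.
- move=> x x0; apply: ynew; exists (elt (n := 0) L0 x).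
  apply/esym; apply: (bisoP ok _ yn x0).
  rewrite (bemb_iso fE) /= => w /eltP/(_ L0)[x' ->].
  by rewrite /= (tower_valE (n := 0)) zero_on0 => /= ->.
Qed.

Lemma cle_tower : cle X tower_set.
Proof.
apply: (cle_inj (f := @elt 0 L0)) => x y /(congr1 val) /= e.
have := congr1 (fun w : {n & tower n} => if w is existT 0 x then Some x else
  None) e.
by case.
Qed.

(** Take two copies of the full tower, one wholly coloured and one wholly uncoloured. In a joint
    extension a single bubble of the first copy already makes [f0] surjective, so some point is both
    coloured and uncoloured. *)
Lemma tower_not_JEP (mu : Small) : first_measurable mu -> ~ cle mu X ->
  inhabited X -> ~ JEP (bubble_class L) tower_set.
Proof.
move=> mumeas muX [x0] [_ joint].
pose M (c : Prop) := bubble_structure (fun=> c) (fun _ : tower_set =>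
  tower_bubble).
have MK c : @member (bubble_class L) _ (M c).
  apply/bubble_class_memberP; exists (fun=> tower_bubble) => i.
  by split; [exact: tower_bubble_ok|exact: bubble_structure_describes].
have size c : univ (M c) #= [set: tower_set].
  by apply/card_eq_cle; split; exact: cle_refl.
have [T [N [f0 [f1 [NK]]]]] := joint _ _ _ _ (MK True) (size True) (MK False)
  (size False).
have emb c (f : M c -> N) : @strong_embedding (bubble_class L) _ _ (M c) N f ->
  embedding f.
  move=> [M' [[_ _ [k kE kv]] [g [gE _] gf]]].
  rewrite (_ : f = k \o g); first exact: embedding_comp.
  by apply: funext => x; apply: val_inj; rewrite /= kv gf.
move=> /emb f0E /emb f1E.
have /bubble_class_memberP[b bP] := NK.
pose w0 : tower_set := @elt 0 L0 x0.
have [ok bD] := bP (f0 w0).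
have fE := embedding_describes f0E
  (@bubble_structure_describes _ _ (fun=> True) (fun=> tower_bubble) w0) bD.
have [w e] := tower_bubble_maximal mumeas muX ok fE (f1 w0).
have : color (f0 w) by rewrite (color_emb f0E).
by rewrite e (color_emb f1E).
Qed.

End Tower.

(** * Joint embedding in the two tower classes *)

Lemma cle_fun (A B : Small) : cle A B -> cle (A -> nat) (B -> nat).
Proof.
move=> /cleP[f fI].
have [r rP] := partial_inverse f.
apply: (@cle_inj _ _ (fun h y => if r y is Some x then h x else 0)) => h h' e.
apply: funext => x; have := congr1 (@^~ (f x)) e.
by case: (r (f x)) (rP (f x)) => [x' /fI ->|/(_ x)].
Qed.

Definition power (kappa : Small) : Prop := exists chi : Small,
  cle kappa (chi -> nat) /\ cle (chi -> nat) kappa.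

Definition two_levels : set nat := [set n | n <= 1].

(** If level 0 had no room, [kappa] would be [level b 0 -> nat] up to equipotence, because by
    extensionality both levels inject into that set. *)
Lemma nonpower_JEP (kappa : Small) : cle nat kappa -> ~ power kappa ->
  JEP (bubble_class two_levels) kappa.
Proof.
move=> natk npow; apply: bubble_class_JEP => // I b ok Ik kI.
exists 0 => // small; apply: npow; exists (level b 0); split=> //.
have I01 : cle I (level b 0 + level b 1)%type.
  have dec x : exists s : level b 0 + level b 1,
      match s with inl d => val d | inr d => val d end = x.
    case e: (blev b x) (blevP ok x) => [|[|//]] _.
      by exists (inl (SigSub (mem_set (e : level b 0 x)))).
    by exists (inr (SigSub (mem_set (e : level b 1 x)))).
  have [g gK] := choice dec.
  by apply: (cle_inj (f := g)) => x y e; rewrite -(gK x) -(gK y) e.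
have [[x0]|none] := pselect (inhabited (level b 0)).
  apply: cle_trans kI _; apply: cle_trans I01 _.
  have nat_le : cle nat (level b 0 -> nat).
    by apply: (@cle_inj _ _ (fun n _ => n)) => m n /(congr1 (@^~ x0)).
  apply: cle_sum_inf => //; last exact: level_ext ok.
  apply: (@cle_inj _ _ (fun x => zero_on [set x])) => x y e.
  by have := congr1 (@^~ x) e; rewrite zero_on_in // => /esym; rewrite zero_on0.
(* If level 0 is empty, two distinct functions of level 1 have no point at which to differ. *)
exfalso; have lev1 x : blev b x = 1.
  case e: (blev b x) (blevP ok x) => [|[|//]] // _.
  by case: none; exact: (inhabits (SigSub (mem_set (e : level b 0 x)))).
have /cleP[i iI] := cle_trans natk kI.
have [|d _] := bdifP ok (lev1 (i 0)) (lev1 (i 1)); first by move/iI.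
by have := lev1 (bdif b (i 0) (i 1)); rewrite d.
Qed.

(** A finite base [chi] leaves only countably many functions [chi -> nat]. *)
Lemma power_base_infinite (kappa chi : Small) : ~ cle kappa nat ->
  cle kappa (chi -> nat) -> cle nat chi.
Proof.
move=> unc kchi; apply: contrapT => /finite_setPn/finite_setP[n].
have In : cle `I_n 'I_n.
  apply: (@cle_inj `I_n 'I_n (fun x => Ordinal (set_valP x))) =>
    x y /(congr1 val) /= e.
  exact: val_inj.
rewrite card_eq_le => /andP[/card_le_cle chin _]; apply: unc.
apply: cle_trans kchi _; apply: cle_trans (cle_ord_fun n (cle_refl nat)).
apply: cle_fun; apply: cle_trans In; apply: cle_trans chin; exact: cle_setT.
Qed.

(* Koenig's argument: [kappa = kappa ^ nat] is not the union of countably many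
   smaller levels. *)
Lemma power_JEP (kappa : Small) : ~ cle kappa nat -> power kappa ->
  JEP (bubble_class setT) kappa.
Proof.
move=> unc [chi [kchi chik]].
have natchi := power_base_infinite unc kchi.
have natk : cle nat kappa by case: (cle_total nat kappa).
apply: bubble_class_JEP => // I b ok Ik kI.
apply: contrapT => none.
have small n : cle (level b n -> nat) kappa.
  by apply: contrapT => big; apply: none; exists n.
have lev_small n : ~ cle kappa (level b n).
  by move=> /cle_fun h; apply: (@cantor kappa); exact: cle_trans h (small n).
(* Countable sequences in [chi -> nat] are functions on [nat * chi], which has the size of [chi]. *)
have /cleP[e eI] : cle (nat -> chi -> nat) I.
  apply: cle_trans kI; apply: cle_trans chik.
  apply: (@cle_trans _ (nat * chi -> nat)).
    apply: (@cle_inj _ _ (fun h p => h p.1 p.2)) => h h' eh.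
    by apply: funext => n; apply: funext => x; exact: (congr1 (@^~ (n, x)) eh).
  by apply: cle_fun; apply: cle_prod_inf => //; exact: cle_refl.
(* Level [n] is too small for the [n]-th coordinates of its sequences to cover [chi -> nat]. The
   sequence of missed values [c] then belongs to no level. *)
have /choice[c cP] n : exists c : chi -> nat, forall g, blev b (e g) = n ->
  g n <> c.
  apply: contrapT => H; apply: (@lev_small n); apply: cle_trans kchi _.
  have /choice[g gP] c : exists g, blev b (e g) = n /\ g n = c.
    apply: contrapT => H'; apply: H; exists c => g gn gc.
    by apply: H'; exists g.
  have gl c : level b n (e (g c)) by case: (gP c).
  apply: (@cle_inj _ _ (fun c => SigSub (mem_set (gl c)))) => c c' [/eI gg].
  by case: (gP c) => _ <-; case: (gP c') => _ <-; rewrite gg.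
exact: (cP (blev b (e c)) c).
Qed.

Theorem corollary3p13 :
  forall mu : Small, first_measurable mu ->
  forall nu : Small, is_mu_JEP nat nu -> cle mu nu.
Proof.
move=> mu mumeas nu [hanf _]; apply: contrapT => munu.
(* The full tower over [nu] has size at least [nu], and [nu] lies below the first measurable, so
   joint embedding fails at that size. *)
have fail (L : set nat) : L 0 -> L 1 -> (forall n, L n.+1 -> L n) ->
    inhabited nu -> ~ cofinally_below (JEP (bubble_class L)) nu.
  move=> L0 L1 Lpred nu0 cof.
  apply: (tower_not_JEP L0 L1 Lpred mumeas munu nu0).
  apply: (hanf _ (bubble_class_aec L) (bubble_class_LS L) cof).
  exact: cle_tower.
have [small|] := pselect (forall gamma, clt gamma nu -> cle gamma nat).
  (* At least [nu] and uncountable. *)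
  pose lambda := (nu + (nat -> nat))%type.
  apply: (@naming_not_JEP lambda).
    move=> h; apply: (@cantor nat); apply: cle_trans h.
    by apply: (@cle_inj _ _ inr) => x y [].
  apply: (hanf _ naming_class_aec naming_class_LS).
    move=> alpha anu; exists alpha; split=> //; first exact: cle_refl.
    by apply: naming_JEP; exact: small.
  by apply: (@cle_inj _ _ inl) => x y [].
move=> /existsNP[gamma /not_implyP[gnu gunc]].
have max A B : clt A nu -> clt B nu -> exists C, [/\ clt C nu,
  cle A C & cle B C].
  move=> Anu Bnu; have [AB|BA] := cle_total A B.
    by exists B; split=> //; exact: cle_refl.
  by exists A; split=> //; exact: cle_refl.
have nu0 : inhabited nu.
  have [natg|//] := cle_total nat gamma.
  by case: gnu => /(cle_trans natg)/cleP[i _] _; exact: (inhabits (i 0)).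
(* Either infinite non-powers are cofinal below [nu] and two levels suffice, or from some point on
   only powers occur and all levels are used. *)
have [cof|] := pselect (cofinally_below (fun k => cle nat k /\ ~ power k) nu).
  apply: (fail two_levels) => //; first by move=> n; exact: ltnW.
  move=> alpha /cof[k [ak knu [natk npow]]]; exists k; split=> //.
  exact: nonpower_JEP.
move=> /existsNP[alpha /not_implyP[anu none]].
(* Going above [alpha] makes [k] a power, and above [gamma] makes it uncountable, as [power_JEP]
   needs. *)
apply: (fail setT) => // beta bnu.
have [d [dnu ad gd]] := max _ _ anu gnu; have [k [knu dk bk]] :=
  max _ _ dnu bnu.
exists k; split=> //.
have kunc : ~ cle k nat.
  by move=> kn; apply: gunc; apply: cle_trans gd _; exact: cle_trans dk kn.
apply: power_JEP => //; apply: contrapT => npow; apply: none.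
exists k; split=> //; first exact: cle_trans ad dk.
by split=> //; case: (cle_total nat k).
Qed.
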